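(* Let $X$ be a Banach space. The following claims are equivalent. (1) $X$ has the Radon-Nikodym property. (2) Every Banach space isomorphic to $X$ has property $A_M$. (3) Every Banach space isomorphic to $X$ has property $B_M$.
   Context: Banach spaces are over $\mathbb{K}=\mathbb{R}$ or $\mathbb{C}$ (the same field for all spaces involved) and are nonzero. $\mathcal{L}(X,Y)$ is the space of bounded linear operators from $X$ to $Y$ with the operator norm; $S_X$ is the unit sphere of $X$. For $T\in\mathcal{L}(X,Y)$ the minimum norm is $m(T):=\inf\{\|T(x)\|: x\in S_X\}$, and $T$ attains its minimum norm if there is $x\in S_X$ with $\|T(x)\|=m(T)$; $\operatorname{MA}(X,Y)$ is the set of all such operators. A Banach space $X$ has property $A_M$ if for every Banach space $Y$, $\operatorname{MA}(X,Y)$ is dense in $\mathcal{L}(X,Y)$; it has property $B_M$ if for every Banach space $Y$, $\operatorname{MA}(Y,X)$ is dense in $\mathcal{L}(Y,X)$. ''Isomorphic'' means linearly isomorphic (linear homeomorphism). A Banach space $X$ has the Radon-Nikodym property if every non-empty closed and bounded subset $C$ of $X$ is dentable, i.e. for every $\varepsilon>0$ there is $x\in C$ not belonging to the closed convex hull of $\{z\in C:\|z-x\|\geq\varepsilon\}$. *)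

(* Defs.v *)
From HB Require Import structures.
From mathcomp Require Import all_boot all_order all_algebra.
From mathcomp Require Export complex.
From mathcomp Require Import all_classical all_reals all_analysis.

Set Implicit Arguments.
Unset Strict Implicit.
Unset Printing Implicit Defensive.

Import Order.TTheory GRing.Theory Num.Theory.
Import numFieldNormedType.Exports.

Local Open Scope classical_set_scope.
Local Open Scope ring_scope.

(* The definitions are stated over an arbitrary numFieldType K and are meant for
   K = R or K = R[i] with R : realType. In the latter case norms take values in
   R[i], whose order is partial: x <= y holds iff y - x is a nonnegative real.
   Hence the bounds of a nonempty set of real elements of R[i] are real, and the
   order-theoretic infimum and supremum of such a set are the usual ones. For
   the same reason the coefficients allowed by convex_set are the real numbers of
   [0, 1], also when K = R[i]. *)

Definition nonzero_space (K : numFieldType) (X : normedModType K) : Prop :=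
  exists x : X, x != 0.

Definition bounded_operator (K : numFieldType) (X Y : normedModType K)
    (T : {linear X -> Y}) : Prop :=
  bounded_near T (nbhs (0 : X)).

Definition unit_sphere (K : numFieldType) (X : normedModType K) : set X :=
  [set x : X | `|x| = 1].
Arguments unit_sphere {K} X.

Definition op_norm (K : numFieldType) (X Y : normedModType K) (f : X -> Y) : K :=
  supremum 0 [set `|f x| | x in [set x : X | `|x| <= 1]].

Definition min_norm (K : numFieldType) (X Y : normedModType K) (f : X -> Y) : K :=
  infimum 0 [set `|f x| | x in unit_sphere X].

Definition attains_min_norm (K : numFieldType) (X Y : normedModType K)
    (f : X -> Y) : Prop :=
  exists2 x, unit_sphere X x & `|f x| = min_norm f.

Definition MA (K : numFieldType) (X Y : normedModType K) :
    set {linear X -> Y} :=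
  [set T | bounded_operator T /\ attains_min_norm T].
Arguments MA {K} X Y.

Definition MA_dense (K : numFieldType) (X Y : normedModType K) : Prop :=
  forall T : {linear X -> Y}, bounded_operator T ->
  forall e : K, 0 < e ->
  exists2 S : {linear X -> Y}, MA X Y S & op_norm (S \- T) < e.

Definition property_AM (K : numFieldType) (X : completeNormedModType K) : Prop :=
  forall Y : completeNormedModType K, nonzero_space Y -> MA_dense X Y.

Definition property_BM (K : numFieldType) (X : completeNormedModType K) : Prop :=
  forall Y : completeNormedModType K, nonzero_space Y -> MA_dense Y X.

Definition isomorphic (K : numFieldType) (X Y : normedModType K) : Prop :=
  exists (f : {linear X -> Y}) (g : {linear Y -> X}),
    [/\ cancel f g, cancel g f, continuous f & continuous g].

Definition closed_convex_hull (K : numFieldType) (X : normedModType K)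
    (A : set X) : set X :=
  smallest [set C : set X | closed C /\ convex_set (C : set (convex_lmodType X))]
    A.

Definition dentable (K : numFieldType) (X : normedModType K) (C : set X) : Prop :=
  forall e : K, 0 < e ->
  exists2 x, C x & ~ closed_convex_hull [set z | C z /\ e <= `|z - x|] x.

Definition radon_nikodym_property (K : numFieldType)
    (X : completeNormedModType K) : Prop :=
  forall C : set X, C !=set0 -> closed C -> bounded_set C -> dentable C.

(* Main.v *)
(** An operator [T] that is not bounded below is a limit of operators
[z |-> T z - (f z / f x) *: T x], which vanish at [x]. If [T] is bounded below
on a space with the Radon-Nikodym property, Stegall's variational principle
gives a small functional [f] such that [`|x| + re (f x)] has a maximum [x0] on
[{x | `|T x| <= 1}]; for the rank one perturbation
[U x = x + f x *: (x0 / `|x0|)] of the identity, [T \o U^-1] then attains its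
minimum norm at the direction of [U x0]. This is property A_M, and property B_M
follows because a space that embeds into a space with the Radon-Nikodym
property has it too.

Conversely (Huff), suppose that [X] contains a nondentable bounded set, which
can be taken countable. Thicken it to the unit ball of an equivalent norm [G],
still nondentable, and let [N] be an equivalent norm whose unit ball is dented at
every point that is close to the separable subspace spanned by the set. If an
operator [S], close to the identity from [(X, N)] to [(X, G)], attained its
minimum norm at [z0], then [S^-1] would map a multiple of the ball of [G] into
the ball of [N], carrying the nondentability at [S z0] over to [z0]. *)

Require Import Defs.
From HB Require Import structures.
From mathcomp Require Import all_boot all_order all_algebra.
From mathcomp Require Import all_classical all_reals all_analysis.
From mathcomp Require Import ring lra.

Set Implicit Arguments.
Unset Strict Implicit.
Unset Printing Implicit Defensive.

Import Order.TTheory GRing.Theory Num.Theory.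
Import numFieldNormedType.Exports.

Local Open Scope classical_set_scope.
Local Open Scope ring_scope.

(** * Real and complex scalars *)

(** For [T] bounded below, everything rests on [|U z| <= |z| + |f z| <= |T z| * |U x0|]: the second
    inequality is the maximality of [x0] made homogeneous, and it is sharp at [x0] because [U x0] is
    a multiple of [x0], whose norm is at least [|x0| + re (f x0)]. For the converse, the obstacle is
    that [X] may be nonseparable, and then a norm whose ball is dented at every point of its sphere
    is not to be expected. The norm [N] adds to the given one a weighted sum with one term for each
    element of a countable dense subset of the span, and each term dents the ball only near its
    element. This is enough: the ball of [G] stays within a small distance [r] of the span, so a
    point where the minimum norm is attained lies close to it. The radius within which [N] dents
    depends on [N] alone, so [r], hence [G], is chosen after it. A single pair of norms refutes both
    properties: A_M fails for [X] with [N] and B_M fails for [X] with [G]. *)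

Definition linear_of (K : pzRingType) (X Y : lmodType K) (f : X -> Y)
    (fl : linear f) : {linear X -> Y} :=
  HB.pack_for {linear X -> Y} f (GRing.isLinear.Build K X Y *:%R f fl).

Lemma linear_ofE (K : pzRingType) (X Y : lmodType K) (f : X -> Y)
  (fl : linear f) x : linear_of fl x = f x.
Proof. by []. Qed.

(* Treats [K = R] and [K = R[i]] at once; norms, whose values in [K] are
   nonnegative, are turned into elements of [R] by [re]. *)
Record scalar_field (R : realType) (K : numFieldType) := ScalarField {
  ofR : {rmorphism R -> K};
  re : K -> R;
  ler_ofR : forall a b, (ofR a <= ofR b) = (a <= b);
  reD : forall k l, re (k + l) = re k + re l;
  reM : forall a k, re (ofR a * k) = a * re k;
  ofRK : cancel ofR re;
  reK : forall k, 0 <= k -> ofR (re k) = k;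
  re_dist1 : forall k, re `|k - 1| ^+ 2 = re `|k| ^+ 2 - 2 * re k + 1;
  extend_functional : forall (X : lmodType K) (g : X -> R),
    (forall x y, g (x + y) = g x + g y) ->
    (forall a x, g (ofR a *: x) = a * g x) ->
    exists f : {linear X -> K^o}, forall x, re (f x) = g x;
  scalars_separable : exists q : nat -> K,
    forall k (e : R), 0 < e -> exists n, re `|k - q n| < e
}.

Lemma rat_dense (R : realType) : exists q : nat -> R,
  forall k e : R, 0 < e -> exists n, `|k - q n| < e.
Proof.
exists (fun n => if unpickle n is Some r then ratr (r : rat) else 0).
move=> k e e0.
have [r] := @rat_in_itvoo R (k - e) (k + e) ltac:(lra).
rewrite in_itv/= => /andP[r1 r2]; exists (pickle r).
by rewrite pickleK ltr_norml; apply/andP; split; lra.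
Qed.

Lemma scalar_field_real (R : realType) : scalar_field R R.
Proof.
apply: (@ScalarField R R idfun id) => //.
- by move=> k; rewrite !real_normK ?num_real//; ring.
- move=> X g gD gZ.
  have gl : linear (g : X -> R^o) by move=> a x y; rewrite gD gZ.
  by exists (linear_of gl).
- have [q qP] := rat_dense R; exists q => k e e0.
  exact: qP.
Qed.

Lemma scalar_field_complex (R : realType) : scalar_field R R[i].
Proof.
have Re_scale (a : R) (k : R[i]) : complex.Re (a%:C%C * k) = a * complex.Re k.
  by case: k => x y /=; rewrite mul0r subr0.
apply: (@ScalarField R R[i] (real_complex R) (@complex.Re R)) => //.
- by move=> a b; rewrite lecR.
- by move=> [a b] [c d].
- move=> k; rewrite lecE => /andP[/eqP k0 _].
  by apply/eqP; rewrite eq_complex/= k0 !eqxx.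
- move=> [a b]; rewrite !normc_def/= !sqr_sqrtr ?addr_ge0 ?sqr_ge0//.
  by rewrite subr0; ring.
- move=> X g gD gZ.
  (* Complex linearity forces the imaginary part at [x] to be minus the real part at [i x]. *)
  pose f x : R[i]^o := (g x +i* - g ('i%C *: x))%C.
  have gN x : g (- x) = - g x.
    by rewrite -scaleN1r -(rmorph1 (real_complex R)) -rmorphN gZ mulN1r.
  have fD x y : f (x + y) = f x + f y.
    by rewrite /f scalerDr !gD; apply/eqP; rewrite eq_complex/= opprD !eqxx.
  have fZ (a : R[i]) x : f (a *: x) = a * f x.
    case: a => a b.
    have aE : (a +i* b)%C = a%:C%C + b%:C%C * 'i%C :> R[i].
      by apply/eqP; rewrite eq_complex/=; apply/andP; split; apply/eqP; ring.
    have ii : 'i%C * 'i%C = - 1 :> R[i].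
      by apply/eqP; rewrite eq_complex/=; apply/andP; split; apply/eqP; ring.
    have e1 : (a +i* b)%C *: x = a%:C%C *: x + b%:C%C *: ('i%C *: x).
      by rewrite aE scalerDl scalerA.
    have e2 : 'i%C *: ((a +i* b)%C *: x) = a%:C%C *: ('i%C *: x) - b%:C%C *: x.
      rewrite scalerA aE mulrDr mulrCA ii mulrN1 scalerDl scaleNr.
      by rewrite mulrC scalerA.
    rewrite /f e2 e1 !gD gN !gZ.
    by apply/eqP; rewrite eq_complex/=; apply/andP; split; apply/eqP; ring.
  have fl : linear f by move=> a x y; rewrite fD fZ.
  by exists (linear_of fl).
- have [q qP] := rat_dense R.
  exists (fun n => if unpickle n is Some (i, j) then (q i +i* q j)%C else 0).
  move=> [a b] e e0; have [i iP] := qP a _ (divr_gt0 e0 (ltr0Sn _ 1)).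
  have [j jP] := qP b _ (divr_gt0 e0 (ltr0Sn _ 1)).
  exists (pickle (i, j)); rewrite pickleK normc_def/=.
  rewrite -(ltr_pXn2r (_ : 0 < 2)%N) ?nnegrE ?sqrtr_ge0 ?(ltW e0)//.
  rewrite sqr_sqrtr ?addr_ge0 ?sqr_ge0//.
  rewrite -[(a - q i) ^+ 2]real_normK ?num_real//.
  rewrite -[(b - q j) ^+ 2]real_normK ?num_real//.
  have := normr_ge0 (a - q i); have := normr_ge0 (b - q j); nra.
Qed.

Section scalar_modulus.
Context {R : realType} {K : numFieldType} (s : scalar_field R K).

Definition modulus (k : K) : R := re s `|k|.

Definition rnorm (X : normedModType K) (x : X) : R := re s `|x|.

Lemma normE (X : normedModType K) (x : X) : `|x| = ofR s (rnorm x).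
Proof. by rewrite reK. Qed.

Lemma modulusE k : `|k| = ofR s (modulus k).
Proof. by rewrite reK. Qed.

Lemma ltr_ofR a b : (ofR s a < ofR s b) = (a < b).
Proof. by rewrite !lt_neqAle ler_ofR (inj_eq (can_inj (ofRK s))). Qed.

Lemma ofR_inj : injective (ofR s).
Proof. exact: can_inj (ofRK s). Qed.

Lemma ofR_ge0 a : (0 <= ofR s a) = (0 <= a).
Proof. by rewrite -{1}(rmorph0 (ofR s)) ler_ofR. Qed.

Lemma ofR_gt0 a : (0 < ofR s a) = (0 < a).
Proof. by rewrite -{1}(rmorph0 (ofR s)) ltr_ofR. Qed.

Lemma modulus_ge0 k : 0 <= modulus k.
Proof. by rewrite -ofR_ge0 reK. Qed.

Lemma modulus_ofR a : modulus (ofR s a) = `|a|.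
Proof.
rewrite /modulus; have [a0|a0] := leP 0 a.
  by rewrite !ger0_norm ?ofRK ?ofR_ge0.
have a0' : 0 <= - a by rewrite oppr_ge0 ltW.
by rewrite -[X in re s X]normrN -rmorphN -[RHS]normrN !ger0_norm ?ofRK ?ofR_ge0.
Qed.

Lemma modulusM k l : modulus (k * l) = modulus k * modulus l.
Proof. by rewrite {1}/modulus normrM modulusE reM. Qed.

Lemma modulus1 : modulus 1 = 1.
Proof. by rewrite -(rmorph1 (ofR s)) modulus_ofR normr1. Qed.

Lemma modulusN k : modulus (- k) = modulus k.
Proof. by rewrite /modulus normrN. Qed.

Lemma modulusD k l : modulus (k + l) <= modulus k + modulus l.
Proof. by rewrite -(ler_ofR s) rmorphD -!modulusE ler_normD. Qed.

Lemma modulus0_eq0 k : modulus k = 0 -> k = 0.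
Proof. by move=> k0; apply/normr0_eq0; rewrite modulusE k0 rmorph0. Qed.

Lemma re0 : re s 0 = 0.
Proof. by rewrite -(rmorph0 (ofR s)) ofRK. Qed.

Lemma reN k : re s (- k) = - re s k.
Proof. by apply/eqP; rewrite -addr_eq0 -reD addNr re0. Qed.

Lemma reB k l : re s (k - l) = re s k - re s l.
Proof. by rewrite reD reN. Qed.

(** By [re_dist1], the law of cosines, this amounts to [(|k| - 1)^2 <= |k - 1|^2]. The side on which
    [|k|] lies of 1 decides which triangle inequality is squared. *)
Lemma re_le_modulus k : re s k <= modulus k.
Proof.
have kd := re_dist1 s k; rewrite -/(modulus k) -/(modulus (k - 1)) in kd.
have := modulusD (k - 1) 1; rewrite subrK modulus1 => k1.
have k0 := modulus_ge0 k; have := modulus_ge0 (k - 1) => d0.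
have [m1|m1] := leP 1 (modulus k); first by nra.
have := modulusD k (1 - k); rewrite addrC subrK modulus1.
by rewrite -(modulusN (1 - k)) opprB; nra.
Qed.

Lemma norm_re_le k : `|re s k| <= modulus k.
Proof.
by rewrite ler_norml re_le_modulus andbT lerNl -reN -modulusN re_le_modulus.
Qed.

Lemma unimodular_mul k : exists2 u, modulus u = 1 & u * k = ofR s (modulus k).
Proof.
have [->|k0] := eqVneq k 0.
  by exists 1; rewrite ?modulus1// mulr0 -modulusE normr0.
exists (`|k| / k); last by rewrite divfK// modulusE.
rewrite /modulus normrM normfV normr_id mulfV ?normr_eq0//.
by rewrite -(rmorph1 (ofR s)) ofRK.
Qed.

Section norm.
Context {X : normedModType K}.
Implicit Types x y : X.

Lemma rnorm_ge0 x : 0 <= rnorm x.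
Proof. by rewrite -ofR_ge0 reK. Qed.

Lemma rnormD x y : rnorm (x + y) <= rnorm x + rnorm y.
Proof. by rewrite -(ler_ofR s) rmorphD -!normE ler_normD. Qed.

Lemma rnorm0 : rnorm (0 : X) = 0.
Proof. by rewrite /rnorm normr0 re0. Qed.

Lemma rnormN x : rnorm (- x) = rnorm x.
Proof. by rewrite /rnorm normrN. Qed.

Lemma rdistC x y : rnorm (x - y) = rnorm (y - x).
Proof. by rewrite /rnorm distrC. Qed.

Lemma rnormB x y : rnorm (x - y) <= rnorm x + rnorm y.
Proof. by rewrite -(rnormN y) rnormD. Qed.

Lemma rdistD (x y z : X) : rnorm (x - z) <= rnorm (x - y) + rnorm (y - z).
Proof. by rewrite -(subrKA y x (- z)) rnormD. Qed.

Lemma rnorm0_eq0 x : rnorm x = 0 -> x = 0.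
Proof. by move=> x0; apply/normr0_eq0; rewrite normE x0 rmorph0. Qed.

Lemma rnorm_gt0 x : x != 0 -> 0 < rnorm x.
Proof.
by move=> x0; rewrite lt_def rnorm_ge0 andbT; apply: contra x0 => /eqP/rnorm0_eq0->.
Qed.

Lemma rnormZ k x : rnorm (k *: x) = modulus k * rnorm x.
Proof. by rewrite {1}/rnorm normrZ modulusE reM. Qed.

Lemma rnormZr a x : rnorm (ofR s a *: x) = `|a| * rnorm x.
Proof. by rewrite rnormZ modulus_ofR. Qed.

Lemma rnorm_sum (I : Type) (r : seq I) (F : I -> X) :
  rnorm (\sum_(i <- r) F i) <= \sum_(i <- r) rnorm (F i).
Proof.
elim/big_ind2 : _ => //; first by rewrite rnorm0.
by move=> a b c d ab cd; apply: le_trans (rnormD _ _) (lerD ab cd).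
Qed.

Lemma gt0_ofR (e : K) : 0 < e -> exists2 r, 0 < r & e = ofR s r.
Proof.
move=> e0; exists (re s e); last by rewrite reK// ltW.
by rewrite -ltr_ofR rmorph0 reK// ltW.
Qed.

Lemma closedP (C : set X) : closed C <->
  forall x, (forall e, 0 < e -> exists2 y, C y & rnorm (x - y) < e) -> C x.
Proof.
split=> [cC x xC|xC x].
  apply: cC => B /nbhs_normP[e/= /gt0_ofR[r r0 ->] eB].
  have [y Cy xy] := xC r r0; exists y; split => //; apply: eB.
  by rewrite /ball_/= normE ltr_ofR.
move=> /= cx; apply: xC => e e0.
have [|y [Cy]] := cx (ball x (ofR s e)).
  by apply: nbhsx_ballx; rewrite ofR_gt0.
by rewrite -ball_normE /ball_/= normE ltr_ofR; exists y.
Qed.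

Lemma bounded_setP (C : set X) :
  bounded_set C <-> exists M, forall x, C x -> rnorm x <= M.
Proof.
split => [|[M CM]].
  rewrite /bounded_set /bounded_near => /pinfty_ex_gt0[_ /gt0_ofR[M M0 ->] CM].
  by exists M => x Cx; have := CM x Cx; rewrite /= normE ler_ofR.
have M0 : 0 <= `|M| by []; exists (ofR s `|M|); split.
  by rewrite ger0_real// ofR_ge0.
move=> k Mk x Cx /=; rewrite normE; apply: le_trans (ltW Mk).
by rewrite ler_ofR (le_trans (CM x Cx))// ler_norm.
Qed.

Lemma convexP (C : set X) : convex_set (C : set (convex_lmodType X)) <->
  forall x y t, C x -> C y -> 0 <= t <= 1 -> C (ofR s t *: x + ofR s (1 - t) *: y).
Proof.
split=> [cC x y t Cx Cy /andP[t0 t1]|cC x y t].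
  have t0' : 0 <= ofR s t by rewrite ofR_ge0.
  have t1' : ofR s t <= 1 by rewrite -(rmorph1 (ofR s)) ler_ofR.
  have := cC x y (Itv01 t0' t1') (mem_set Cx) (mem_set Cy) => /set_mem.
  by rewrite /conv/= rmorphB rmorph1.
move=> /set_mem Cx /set_mem Cy; apply/mem_set.
have t0 : 0 <= t%:num by [].
have t1 : t%:num <= 1 by [].
have tE : ofR s (re s t%:num) = t%:num by exact: reK.
have := cC x y (re s t%:num) Cx Cy.
have -> : ofR s (1 - re s t%:num) = 1 - t%:num by rewrite rmorphB tE rmorph1.
rewrite tE; apply; apply/andP; split; first by rewrite -ofR_ge0 tE.
by rewrite -(ler_ofR s) tE (rmorph1 (ofR s)).
Qed.

End norm.

Lemma completeP (X : completeNormedModType K) (u : nat -> X) :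
  (forall e, 0 < e -> exists N, forall m n, (N <= m)%N -> (N <= n)%N ->
    rnorm (u m - u n) < e) ->
  exists x, forall e, 0 < e ->
    exists N, forall n, (N <= n)%N -> rnorm (x - u n) < e.
Proof.
move=> cu.
have /cvg_ex[x ux] : cvg (u @ \oo).
  apply/cauchy_cvgP/cauchy_exP => _ /gt0_ofR[e e0 ->].
  have [N uN] := cu e e0; exists (u N), N => // n /= Nn.
  by rewrite -ball_normE /ball_/= normE ltr_ofR; exact: uN.
exists x => e e0.
have [|N _ uN] := (cvgrPdist_lt _ _).1 ux (ofR s e); first by rewrite ofR_gt0.
by exists N => n /uN; rewrite normE ltr_ofR.
Qed.

Section operators.
Context {X Y : normedModType K}.

Lemma bounded_operatorP (T : {linear X -> Y}) : bounded_operator T <->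
  exists2 c, 0 <= c & forall x, rnorm (T x) <= c * rnorm x.
Proof.
rewrite /bounded_operator; split=> [/linear_boundedP/pinfty_ex_gt0|[c c0 Tc]].
  move=> [_ /gt0_ofR[c c0 ->] cT]; exists c; first exact: ltW.
  by move=> x; have := cT x; rewrite !normE -rmorphM ler_ofR.
apply/linear_boundedP; exists (ofR s c); split; first by rewrite ger0_real ?ofR_ge0.
move=> k ck x; rewrite normE (le_trans _ (ler_wpM2r _ (ltW ck)))//.
by rewrite normE -rmorphM ler_ofR.
Qed.

Lemma continuous_linearP (T : {linear X -> Y}) : continuous T <->
  exists2 c, 0 <= c & forall x, rnorm (T x) <= c * rnorm x.
Proof. by rewrite -bounded_operatorP /bounded_operator linear_bounded_continuous. Qed.

(** [op_norm] is a supremum for the order of [K], which is partial over the complex numbers. The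
    real supremum, sent to [K] by [ofR], is such a supremum, and antisymmetry makes it the only
    one. *)
Lemma op_norm_sup (f : X -> Y) c :
  (forall x, rnorm x <= 1 -> rnorm (f x) <= c) ->
  exists d, [/\ op_norm f = ofR s d, d <= c &
                forall x, rnorm x <= 1 -> rnorm (f x) <= d].
Proof.
move=> fc; pose A := [set rnorm (f x) | x in [set x : X | rnorm x <= 1]].
have hA : has_sup A.
  split; first by exists (rnorm (f 0)), 0; rewrite //= rnorm0.
  by exists c => _ [x x1 <-]; exact: fc.
have fA x : rnorm x <= 1 -> rnorm (f x) <= sup A.
  by move=> x1; apply: ub_le_sup; [case: hA|exists x].
have norm1 (x : X) : (`|x| <= 1) = (rnorm x <= 1).
  by rewrite normE -(rmorph1 (ofR s)) ler_ofR.
exists (sup A); split => //; last first.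
  by apply: ge_sup => [|_ [x x1 <-]]; [case: hA|exact: fc].
have supA : supremums [set `|f x| | x in [set x : X | `|x| <= 1]] (ofR s (sup A)).
  split => [_ [x /= x1 <-]|k kub].
    by rewrite normE ler_ofR fA -?norm1.
  have k0 : 0 <= k.
    by apply: (le_trans (normr_ge0 (f 0))); apply: kub; exists 0; rewrite //= normr0.
  rewrite -(reK s k0) ler_ofR; apply: ge_sup => [|_ [x x1 <-]]; first by case: hA.
  rewrite -(ler_ofR s) (reK s k0) -normE; apply: kub; exists x => //=.
  by rewrite norm1.
rewrite /op_norm /supremum; case: ifPn => [/eqP A0|_].
  by have : set0 `|f 0|; [rewrite -A0; exists 0; rewrite //= normr0|].
case: xgetP => [y -> [yub ylub]|/(_ _ supA)//].
by apply/eqP; rewrite eq_le ylub ?(supA.2)//; case: supA.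
Qed.

Lemma op_norm_dist_lt (S T : {linear X -> Y}) e :
    bounded_operator S -> bounded_operator T -> op_norm (S \- T) < ofR s e ->
  forall x, rnorm (S x - T x) <= e * rnorm x.
Proof.
move=> /bounded_operatorP[c c0 Sc] /bounded_operatorP[c' c'0 Tc] STe x.
have [|d [dE dc fd]] := @op_norm_sup (S \- T) (c + c').
  move=> z z1 /=; apply: (le_trans (rnormB _ _)).
  by apply: lerD; [apply: le_trans (Sc z) _|apply: le_trans (Tc z) _]; nra.
have {STe} de : d < e by rewrite -ltr_ofR -dE.
have [->|x0] := eqVneq x 0; first by rewrite !raddf0 addr0 !rnorm0 mulr0.
have nx := rnorm_gt0 x0.
have := fd (ofR s (rnorm x)^-1 *: x).
have -> : (S \- T) (ofR s (rnorm x)^-1 *: x) = ofR s (rnorm x)^-1 *: (S x - T x).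
  by rewrite scalerBr /= !linearZ.
rewrite !rnormZr.
rewrite gtr0_norm ?invr_gt0// mulVf ?gt_eqF// => /(_ (lexx _)).
by rewrite mulrC ler_pdivrMr// => /le_trans; apply; rewrite ler_wpM2r ?ltW.
Qed.

Lemma op_norm_lt (S T : {linear X -> Y}) c e : 0 <= c -> c < e ->
  (forall x, rnorm (S x - T x) <= c * rnorm x) -> op_norm (S \- T) < ofR s e.
Proof.
move=> c0 ce STc; have [|d [-> dc _]] := @op_norm_sup (S \- T) c.
  by move=> x x1 /=; apply: le_trans (STc x) _; rewrite ler_piMr.
by rewrite ltr_ofR (le_lt_trans dc).
Qed.

Lemma unit_sphereE (x : X) : unit_sphere X x <-> rnorm x = 1.
Proof.
rewrite /unit_sphere/= normE -(rmorph1 (ofR s)); split => [/ofR_inj//|->//].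
Qed.

Lemma attains_min_normP (f : X -> Y) : attains_min_norm f <->
  exists2 x, rnorm x = 1 & forall z, rnorm z = 1 -> rnorm (f x) <= rnorm (f z).
Proof.
split=> [[x x1 fx]|[x x1 fx]].
  exists x; first exact/unit_sphereE.
  move=> z /unit_sphereE z1; rewrite -(ler_ofR s) -!normE fx /min_norm /infimum.
  by case: ifPn => // _; case: xgetP => // y -> [+ _]; apply; exists z.
exists x; first exact/unit_sphereE.
have infA : infimums [set `|f x| | x in unit_sphere X] `|f x|.
  split => [_ [z /unit_sphereE z1 <-]|k]; first by rewrite !normE ler_ofR fx.
  by apply; exists x => //; exact/unit_sphereE.
rewrite /min_norm /infimum; case: ifPn => [/eqP A0|_].
  by have : set0 `|f x|; [rewrite -A0; exists x => //; exact/unit_sphereE|].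
case: xgetP => [y -> [ylb ylub]|/(_ _ infA)//].
by apply/eqP; rewrite eq_le ylub ?infA.2//; case: infA.
Qed.

End operators.

End scalar_modulus.

(** * The Hahn-Banach theorem *)

Section hahn_banach.
Context {R : realType} {V : lmodType R}.
Implicit Types (p q : V -> R) (M : set (V * R)).

Definition sublinear p := (forall x y, p (x + y) <= p x + p y) /\
  forall (a : R) x, 0 < a -> p (a *: x) <= a * p x.

Lemma sublinearZ p a x : sublinear p -> 0 < a -> p (a *: x) = a * p x.
Proof.
move=> [_ pZ] a0; apply/eqP; rewrite eq_le pZ//=.
have := pZ a^-1 (a *: x); rewrite scalerA mulVf ?gt_eqF// scale1r invr_gt0.
by move=> /(_ a0); rewrite ler_pdivlMl.
Qed.

Lemma sublinear0 p : sublinear p -> p 0 = 0.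
Proof.
by move=> sp; have := sublinearZ 0 sp (ltr0Sn _ 1); rewrite scaler0; lra.
Qed.

Lemma sublinear_geN p x : sublinear p -> - p (- x) <= p x.
Proof.
by move=> sp; have := sp.1 x (- x); rewrite subrr sublinear0//; lra.
Qed.

(** A pair [(x, a)] of the cone stands for the constraint [a <= f x] on the functional [f] to be
    built. *)
Definition convex_cone M := [/\ M (0, 0),
  forall m n, M m -> M n -> M (m.1 + n.1, m.2 + n.2) &
  forall (a : R) m, 0 < a -> M m -> M (a *: m.1, a * m.2)].

(** The largest sublinear functional below [p] that is at most [- a] at [- x] for every constraint
    [(x, a)] of [M]. *)
Definition shift_inf p M x := inf [set p (x + m.1) - m.2 | m in M].

Section shift.
Variables (p : V -> R) (M : set (V * R)).
Hypotheses (sp : sublinear p) (cM : convex_cone M).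
Hypothesis pM : forall m, M m -> m.2 <= p m.1.

Let shift_lb x : lbound [set p (x + m.1) - m.2 | m in M] (- p (- x)).
Proof.
move=> _ [m Mm <-]; have := pM Mm.
by have := sp.1 (x + m.1) (- x); rewrite addrAC subrr add0r; lra.
Qed.

Lemma shift_inf_le x m : M m -> shift_inf p M x <= p (x + m.1) - m.2.
Proof. by move=> Mm; apply: ge_inf; [exists (- p (- x))|exists m]. Qed.

Let le_shift_inf x (b : R) :
  (forall m, M m -> b <= p (x + m.1) - m.2) -> b <= shift_inf p M x.
Proof.
move=> bM; apply: lb_le_inf => [|_ [m Mm <-]]; last exact: bM.
by case: cM => M0 _ _; exists (p (x + 0) - 0), (0, 0).
Qed.

Lemma sublinear_shift_inf : sublinear (shift_inf p M).
Proof.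
case: cM => M0 MD MZ; split=> [x y|a x a0].
  rewrite -lerBlDr; apply: le_shift_inf => m Mm; rewrite lerBlDr [leRHS]addrC -lerBlDr.
  apply: le_shift_inf => n Mn; rewrite lerBlDr.
  apply: le_trans (shift_inf_le _ (MD _ _ Mm Mn)) _ => /=.
  by have := sp.1 (x + m.1) (y + n.1); rewrite addrACA; lra.
rewrite mulrC -ler_pdivrMr//; apply: le_shift_inf => m Mm.
rewrite ler_pdivrMr//; apply: le_trans (shift_inf_le _ (MZ _ _ a0 Mm)) _ => /=.
by rewrite -scalerDr sublinearZ//; lra.
Qed.

Lemma shift_inf_ler x : shift_inf p M x <= p x.
Proof.
by case: cM => M0 _ _; have := shift_inf_le x M0; rewrite /= addr0 subr0.
Qed.

Lemma shift_inf_oppr m : M m -> shift_inf p M (- m.1) <= - m.2.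
Proof.
by move=> Mm; have := shift_inf_le (- m.1) Mm; rewrite addNr sublinear0// sub0r.
Qed.

End shift.

(* Minimality is tested against [fun x => inf_(t >= 0) (p (x + t y) - t p y)]. *)
Lemma minimal_sublinear_linear p : sublinear p ->
    (forall q, sublinear q -> (forall x, q x <= p x) -> forall x, q x = p x) ->
  (forall x y, p (x + y) = p x + p y) /\ (forall a x, p (a *: x) = a * p x).
Proof.
move=> sp pmin.
have pD x y : p (x + y) = p x + p y.
  apply/eqP; rewrite eq_le sp.1/=.
  pose M := [set m : V * R | exists2 t, 0 <= t & m = (t *: y, t * p y)].
  have cM : convex_cone M.
    split; first by exists 0; rewrite // scale0r mul0r.
      move=> _ _ [t t0 ->] [u u0 ->]; exists (t + u); first exact: addr_ge0.
      by rewrite /= scalerDl mulrDl.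
    move=> a _ a0 [t t0 ->]; exists (a * t); first by rewrite mulr_ge0// ltW.
    by rewrite /= scalerA mulrA.
  have pM m : M m -> m.2 <= p m.1.
    move=> [t t0 ->] /=; move: t0; rewrite le_eqVlt => /predU1P[<-|t0].
      by rewrite scale0r mul0r sublinear0.
    by rewrite sublinearZ.
  rewrite -(pmin _ (sublinear_shift_inf sp cM pM) (shift_inf_ler sp cM pM) x).
  rewrite -lerBrDr; apply: (@shift_inf_le p M sp pM x (y, p y)).
  by exists 1; rewrite // scale1r mul1r.
split => // a x.
have pN z : p (- z) = - p z.
  by have := pD z (- z); rewrite subrr sublinear0//; lra.
have [a0|a0|<-] := ltgtP 0 a; first by rewrite sublinearZ.
  by rewrite -[a]opprK scaleNr pN sublinearZ ?mulNr ?oppr_gt0.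
by rewrite scale0r mul0r sublinear0.
Qed.

(** Zorn's lemma for the reversed pointwise order. A chain has its pointwise infimum as a bound,
    finite because [q x >= - q (- x) >= - p (- x)]; it is subadditive because the smaller of two
    members of the chain serves at both points. *)
Lemma exists_minimal_sublinear p : sublinear p ->
  exists q, [/\ sublinear q, forall x, q x <= p x &
    forall r, sublinear r -> (forall x, r x <= q x) -> forall x, r x = q x].
Proof.
move=> sp; pose T := {q | sublinear q /\ forall x, q x <= p x}.
pose r (q q' : T) := `[< forall x, sval q' x <= sval q x >].
have [||||q qmin] := @Zorn T r.
- by move=> q; apply/asboolP.
- move=> q1 q2 q3 /asboolP q12 /asboolP q23; apply/asboolP => x.
  exact: le_trans (q23 x) (q12 x).
- move=> [q1 q1P] [q2 q2P] /asboolP/= q12 /asboolP/= q21; apply/eq_exist.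
  by apply/funext => x; apply/eqP; rewrite eq_le q12 q21.
- move=> A Atot; have [->|/set0P[q0 Aq0]] := eqVneq A set0.
    by exists (exist _ p (conj sp (fun=> lexx _))).
  pose g x := inf [set sval q x | q in A].
  have gle (q : T) x : A q -> g x <= sval q x.
    move=> Aq; apply: ge_inf; last by exists q.
    exists (- p (- x)) => _ [q' _ <-].
    have := sublinear_geN x (svalP q').1; have := (svalP q').2 (- x); lra.
  have leg (b : R) x : (forall q : T, A q -> b <= sval q x) -> b <= g x.
    move=> bA; apply: lb_le_inf => [|_ [q Aq <-]]; last exact: bA.
    by exists (sval q0 x), q0.
  have sg : sublinear g.
    split => [x y|a x a0].
      rewrite -lerBlDr; apply: (leg) => q Aq; rewrite lerBlDr [leRHS]addrC -lerBlDr.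
      apply: (leg) => q' Aq'; rewrite lerBlDr.
      have [/asboolP qq'|/asboolP qq'] := Atot q q' Aq Aq'.
        apply: le_trans (gle _ _ Aq') _; have := (svalP q').1.1 x y.
        by have := qq' x; lra.
      apply: le_trans (gle _ _ Aq) _; have := (svalP q).1.1 x y.
      by have := qq' y; lra.
    rewrite mulrC -ler_pdivrMr//; apply: (leg) => q Aq; rewrite ler_pdivrMr//.
    by apply: le_trans (gle _ _ Aq) _; rewrite mulrC (svalP q).1.2.
  have gp x : g x <= p x by exact: le_trans (gle _ x Aq0) ((svalP q0).2 x).
  exists (exist _ g (conj sg gp)) => q Aq; apply/asboolP => x /=; exact: gle.
exists (sval q); case: (svalP q) => sq qp; split => // r' sr' r'q x.
have r'p y : r' y <= p y by exact: le_trans (r'q y) (qp y).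
by rewrite -(qmin (exist _ r' (conj sr' r'p)))//; apply/asboolP.
Qed.

(** A minimal sublinear functional below [shift_inf p M] is linear, and its bound at [- m.1] is the
    constraint [m]. *)
Lemma hahn_banach_cone p M : sublinear p -> convex_cone M ->
    (forall m, M m -> m.2 <= p m.1) ->
  exists f : V -> R, [/\ forall x y, f (x + y) = f x + f y,
    forall a x, f (a *: x) = a * f x, forall x, f x <= p x &
    forall m, M m -> m.2 <= f m.1].
Proof.
move=> sp cM pM.
have [f [sf fq fmin]] := exists_minimal_sublinear (sublinear_shift_inf sp cM pM).
have [fD fZ] := minimal_sublinear_linear sf fmin.
exists f; split => // [x|m Mm].
  exact: le_trans (fq x) (shift_inf_ler sp cM pM x).
have := le_trans (fq (- m.1)) (shift_inf_oppr sp pM Mm).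
by rewrite -scaleN1r fZ mulN1r lerN2.
Qed.

End hahn_banach.

(** A copy of [X] on which real scalars act through [ofR s], so that the real Hahn-Banach theorem
    applies to complex spaces. *)
Definition realified (R : realType) (K : numFieldType) (s : scalar_field R K)
  (X : lmodType K) : Type := X.

Section realified_lmodule.
Context {R : realType} {K : numFieldType} (s : scalar_field R K).
Variable X : lmodType K.
Local Notation rX := (realified s X).

HB.instance Definition _ := GRing.Zmodule.on rX.

Let scale (a : R) (x : rX) : rX := ofR s a *: (x : X).

Let scaleA a b x : scale a (scale b x) = scale (a * b) x.
Proof. by rewrite /scale scalerA rmorphM. Qed.

Let scale1 : left_id 1 scale.
Proof. by move=> x; rewrite /scale rmorph1 scale1r. Qed.

Let scaleDr : right_distributive scale +%R.
Proof. by move=> a x y; rewrite /scale scalerDr. Qed.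

Let scaleDl x : {morph scale^~ x : a b / a + b}.
Proof. by move=> a b; rewrite /scale rmorphD scalerDl. Qed.

HB.instance Definition _ := GRing.Zmodule_isLmodule.Build R rX
  scaleA scale1 scaleDr scaleDl.

End realified_lmodule.

Section functionals.
Context {R : realType} {K : numFieldType} (s : scalar_field R K).
Context {X : normedModType K}.
Local Notation "`‖ x ‖" := (rnorm s x) (at level 0, x at level 99).
Implicit Types (h : X -> R) (S : set X) (l : seq (R * X)).

Definition real_linear h := (forall x y, h (x + y) = h x + h y) /\
  forall a x, h (ofR s a *: x) = a * h x.

Lemma real_linearN h x : real_linear h -> h (- x) = - h x.
Proof.
by move=> [_ hZ]; rewrite -scaleN1r -(rmorph1 (ofR s)) -rmorphN hZ mulN1r.
Qed.

Lemma real_linearB h x y : real_linear h -> h (x - y) = h x - h y.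
Proof. by move=> hl; rewrite hl.1 real_linearN. Qed.

Lemma hahn_banach_norm (M : set (X * R)) :
    [/\ M (0, 0), forall m n, M m -> M n -> M (m.1 + n.1, m.2 + n.2) &
      forall (a : R) m, 0 < a -> M m -> M (ofR s a *: m.1, a * m.2)] ->
    (forall m, M m -> m.2 <= `‖m.1‖) ->
  exists h, [/\ real_linear h, forall x, h x <= `‖x‖ &
    forall m, M m -> m.2 <= h m.1].
Proof.
move=> cM Mn; have snorm : @sublinear R (realified s X) (@rnorm _ _ s X).
  split=> [x y|a x a0]; first exact: (rnormD s (X := X)).
  by rewrite [leLHS](@rnormZr _ _ s X a x) gtr0_norm.
have [h [hD hZ hn hM]] := hahn_banach_cone (V := realified s X) snorm cM Mn.
by exists h; split.
Qed.

Lemma norming_functional y : exists h,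
  [/\ real_linear h, forall x, h x <= `‖x‖ & h y = `‖y‖].
Proof.
pose M := [set m : X * R | exists2 t, 0 <= t & m = (ofR s t *: y, t * `‖y‖)].
have [||h [hl hn hM]] := @hahn_banach_norm M.
- split; first by exists 0; rewrite // rmorph0 scale0r mul0r.
    move=> _ _ [t t0 ->] [u u0 ->]; exists (t + u); first exact: addr_ge0.
    by rewrite /= rmorphD scalerDl mulrDl.
  move=> a _ a0 [t t0 ->]; exists (a * t); first by rewrite mulr_ge0// ltW.
  by rewrite /= rmorphM scalerA mulrA.
- by move=> _ [t t0 ->] /=; rewrite rnormZr ger0_norm.
exists h; split => //; apply/eqP; rewrite eq_le hn/=.
by apply: (hM (y, `‖y‖)); exists 1; rewrite // rmorph1 scale1r mul1r.
Qed.

(** Rotating [x] by a unimodular scalar makes [f x] equal to its modulus, so a bound on the real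
    part bounds the modulus. *)
Lemma extend_bounded_functional h c : real_linear h ->
    (forall x, h x <= c * `‖x‖) ->
  exists f : {linear X -> K^o}, (forall x, re s (f x) = h x) /\
    forall x, modulus s (f x) <= c * `‖x‖.
Proof.
move=> [hD hZ] hc; have [f fh] := extend_functional hD hZ.
exists f; split => // x; have [u u1 uf] := unimodular_mul s (f x).
have := hc (u *: x); rewrite -fh linearZ/= [u *: f x]uf ofRK => /le_trans; apply.
by rewrite rnormZ u1 mul1r.
Qed.

Definition comb l := \sum_(p <- l) ofR s p.1 *: p.2.

Definition weight l := \sum_(p <- l) p.1.

Definition weighted_in S l := {in l, forall p, 0 <= p.1 /\ S p.2}.

Definition rescale a l := [seq (a * p.1, p.2) | p <- l].

Lemma comb_rescale a l : comb (rescale a l) = ofR s a *: comb l.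
Proof.
rewrite /comb big_map scaler_sumr; apply: eq_bigr => p _ /=.
by rewrite rmorphM scalerA.
Qed.

Lemma weight_rescale a l : weight (rescale a l) = a * weight l.
Proof. by rewrite /weight big_map mulr_sumr. Qed.

Lemma weighted_in_rescale S a l : 0 <= a -> weighted_in S l ->
  weighted_in S (rescale a l).
Proof. by move=> a0 lS _ /mapP[p /lS[p0 Sp] ->]; split=> //=; exact: mulr_ge0. Qed.

Lemma weight_ge0 S l : weighted_in S l -> 0 <= weight l.
Proof.
by move=> lS; rewrite /weight big_seq; apply: sumr_ge0 => p /lS[].
Qed.

Lemma near_convex_hull S x e : 
    (forall h, real_linear h -> (forall y, h y <= `‖y‖) ->
      exists2 z, S z & h z - h x < e) ->
  exists l, [/\ weighted_in S l, weight l = 1 & `‖x - comb l‖ < e].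
Proof.
(* Otherwise Hahn-Banach separates [x] from the convex hull of [S]. *)
move=> Sx; apply: contrapT => /forallNP far.
(* Multiplied by the weight, the inequality [e <= |comb l - x|] becomes homogeneous; combinations of
   arbitrary weight form a cone. *)
pose M := [set m : X * R | exists2 l, weighted_in S l &
  m = (comb l - ofR s (weight l) *: x, e * weight l)].
have [||h [hl hn hM]] := @hahn_banach_norm M.
- split.
  + exists [::] => //.
    by rewrite /comb /weight !big_nil rmorph0 scale0r subr0 mulr0.
  + move=> _ _ [l lS ->] [l' l'S ->]; exists (l ++ l').
      by move=> p; rewrite mem_cat => /orP[/lS|/l'S].
    rewrite /comb /weight !big_cat/= rmorphD scalerDl mulrDr.
    by rewrite addrACA -opprD.
  + move=> a _ a0 [l lS ->]; exists (rescale a l).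
      by apply: weighted_in_rescale => //; exact: ltW.
    by rewrite /= comb_rescale weight_rescale rmorphM -scalerA scalerBr mulrCA.
- move=> _ [l lS ->] /=.
  have := weight_ge0 lS; rewrite le_eqVlt => /predU1P[<-|w0].
    by rewrite mulr0 rnorm_ge0.
  have := far (rescale (weight l)^-1 l); apply: contra_notP => /negP.
  rewrite -ltNge => small; split.
  + by apply: weighted_in_rescale => //; rewrite invr_ge0 ltW.
  + by rewrite weight_rescale mulVf// gt_eqF.
  + rewrite comb_rescale rdistC.
    have -> : ofR s (weight l)^-1 *: comb l - x =
        ofR s (weight l)^-1 *: (comb l - ofR s (weight l) *: x).
      by rewrite scalerBr scalerA -rmorphM mulVf ?gt_eqF// rmorph1 scale1r.
    by rewrite rnormZr gtr0_norm ?invr_gt0// mulrC ltr_pdivrMr.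
have [z Sz] := Sx h hl hn; apply/negP; rewrite -leNgt -real_linearB//.
apply: (hM (z - x, e)); exists [:: (1, z)].
  by move=> p; rewrite inE => /eqP ->.
by rewrite /comb /weight !big_seq1/= rmorph1 !scale1r mulr1.
Qed.

End functionals.

(** * Dentability and bushes *)

Lemma half_expn_lt (R : realType) (c e : R) : 0 < e ->
  exists N, forall n, (N <= n)%N -> c * 2^-1 ^+ n < e.
Proof.
move=> e0; exists (Num.bound (`|c| / e)) => n Nn.
have cn : `|c| / e < 2 ^+ n.
  apply: lt_le_trans (archi_boundP _) _; first by rewrite divr_ge0// ltW.
  rewrite -natrX ler_nat; apply: leq_trans Nn _.
  by apply: ltnW; apply: ltn_expl.
rewrite exprVn ltr_pdivrMr ?exprn_gt0//; apply: le_lt_trans (ler_norm c) _.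
by rewrite mulrC -ltr_pdivrMr.
Qed.

Section dentability.
Context {R : realType} {K : numFieldType} (s : scalar_field R K).
Context {X : normedModType K}.
Local Notation "`‖ x ‖" := (rnorm s x) (at level 0, x at level 99).
Implicit Types (A C E G : set X) (l : seq (R * X)).

Lemma subset_hull A : A `<=` closed_convex_hull A.
Proof. exact: sub_gen_smallest. Qed.

Lemma hull_min A C : closed C -> convex_set (C : set (convex_lmodType X)) ->
  A `<=` C -> closed_convex_hull A `<=` C.
Proof. by move=> cC vC; apply: smallest_sub. Qed.

Lemma closed_hull A : closed (closed_convex_hull A).
Proof. by apply: closed_bigI => C [[]]. Qed.

Lemma convex_hull A : convex_set (closed_convex_hull A : set (convex_lmodType X)).
Proof.
move=> x y t /set_mem Ax /set_mem Ay; apply/mem_set => C CA.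
by apply/set_mem/CA.1.2; apply/mem_set; [exact: Ax|exact: Ay].
Qed.

Lemma hullS A C : A `<=` closed_convex_hull C ->
  closed_convex_hull A `<=` closed_convex_hull C.
Proof. by apply: hull_min; [exact: closed_hull|exact: convex_hull]. Qed.

Lemma convex_comb C l : convex_set (C : set (convex_lmodType X)) ->
  weighted_in C l -> weight l = 1 -> C (comb s l).
Proof.
move=> /(convexP s) cC lC l1.
(* The tail of a list of weight 1 has another weight, possibly 0, so the induction is on normalized
   combinations. *)
suff : forall l, weighted_in C l -> 0 < weight l ->
    C (ofR s (weight l)^-1 *: comb s l).
  by move=> /(_ l lC); rewrite l1 invr1 rmorph1 scale1r; exact.
move=> {l lC l1} l; elim: l => [|[a x] l ih] lC.
  by rewrite /weight big_nil ltxx.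
have [a0 Cx] := lC (a, x) (mem_head _ _); rewrite /= in a0 Cx.
have {}lC : weighted_in C l by move=> p pl; apply: lC; rewrite inE pl orbT.
have := weight_ge0 lC; rewrite /weight /comb !big_cons/= -/(weight l) -/(comb s l).
rewrite le_eqVlt => /predU1P[l0|l0] al0.
  rewrite -l0 addr0 in al0 *.
  have -> : comb s l = 0.
    rewrite /comb big_seq big1// => p pl.
    suff -> : p.1 = 0 by rewrite rmorph0 scale0r.
    have /eqP := esym l0; rewrite /weight big_seq psumr_eq0 => [/allP|q /lC[]//].
    by move=> /(_ _ pl); rewrite pl => /eqP.
  by rewrite addr0 scalerA -rmorphM mulVf ?gt_eqF// rmorph1 scale1r.
have := cC _ _ (a / (a + weight l)) Cx (ih lC l0).
have -> : 1 - a / (a + weight l) = (a + weight l)^-1 * weight l.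
  by field; rewrite gt_eqF.
rewrite scalerA -rmorphM -mulrA mulfV ?gt_eqF// mulr1 scalerDr scalerA -rmorphM.
rewrite [_ * a]mulrC; apply; apply/andP; split; first by rewrite divr_ge0// ltW.
by rewrite ler_pdivrMr// mul1r lerDl ltW.
Qed.

Definition nondentable (e : R) C := forall x, C x ->
  closed_convex_hull [set z | C z /\ e <= `‖z - x‖] x.

Lemma not_dentableP C :
  ~ dentable C <-> exists2 e, 0 < e & nondentable e C.
Proof.
split=> [nC|[e e0 eC] /(_ (ofR s e))].
  apply: contrapT => nnC; apply: nC => _ /(gt0_ofR s)[e e0 ->].
  apply: contrapT => hC; apply: nnC; exists e => // x Cx.
  apply: contrapT => hx; apply: hC; exists x => // hx'; apply: hx.
  move: hx'; apply: hullS => z [Cz]; rewrite (normE s) ler_ofR => ez.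
  exact: subset_hull.
rewrite ofR_gt0 => /(_ e0)[x Cx]; apply; have := eC x Cx.
apply: hullS => z [Cz ez]; apply: subset_hull; split => //.
by rewrite (normE s) ler_ofR.
Qed.

(** A point [y] of [E] is either [e']-far from [x], or so close to [x] that the points of [E] at
    distance [e] from [y], whose hull contains [y], are [e']-far from [x]. *)
Lemma nondentable_hull e e' E G : nondentable e E -> E `<=` G ->
  G `<=` closed_convex_hull E -> e' + e' < e -> nondentable e' G.
Proof.
move=> nE EG GE e'e x Gx; have := GE x Gx; apply: hullS => y Ey.
have [yx|yx] := leP e' `‖y - x‖; first by apply: subset_hull; split => //; exact: EG.
have := nE y Ey; apply: hullS => z [Ez zy]; apply: subset_hull.
split; first exact: EG.
by have := rdistD s z x y; rewrite (rdistC s x y) /=; lra.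
Qed.

Lemma closed_ball_hull (x : X) (e : R) : closed [set y | `‖y - x‖ <= e] /\
  convex_set ([set y | `‖y - x‖ <= e] : set (convex_lmodType X)).
Proof.
split; last first.
  apply/(convexP s) => y z t /= yx zx /andP[t0 t1].
  have -> : ofR s t *: y + ofR s (1 - t) *: z - x =
      ofR s t *: (y - x) + ofR s (1 - t) *: (z - x).
    rewrite !scalerBr addrACA -opprD -scalerDl -rmorphD.
    by rewrite [t + _]addrC subrK rmorph1 scale1r.
  apply: le_trans (rnormD _ _ _) _; rewrite !rnormZr !ger0_norm ?subr_ge0//.
  by nra.
apply/(closedP s) => y yx /=; apply/ler_addgt0Pr => d d0.
have [z /= zx zy] := yx d d0.
by apply: le_trans (rdistD s y z x) _; lra.
Qed.

Lemma hull_bounded (M : R) A : (forall x, A x -> `‖x‖ <= M) ->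
  forall x, closed_convex_hull A x -> `‖x‖ <= M.
Proof.
move=> AM x; have [cB vB] := closed_ball_hull 0 M.
move=> /(hull_min cB vB); rewrite /= subr0; apply => y /AM /=.
by rewrite subr0.
Qed.

End dentability.

(** The property speaks of closed sets only. The closed convex hull of [C] is closed, and still
    nondentable once [e] is reduced to [e / 3]. *)
Lemma rnp_nondentable (R : realType) (K : numFieldType) (s : scalar_field R K)
    (X : completeNormedModType K) (C : set X) (e M : R) :
    radon_nikodym_property X -> C !=set0 ->
    (forall x, C x -> rnorm s x <= M) -> 0 < e -> ~ nondentable s e C.
Proof.
move=> rnpX [x Cx] CM e0 nC; have : dentable (closed_convex_hull C).
  apply: rnpX; first by exists x; exact: subset_hull.
    exact: closed_hull.
  by apply/(bounded_setP s); exists M; exact: hull_bounded.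
apply/(not_dentableP s); exists (e / 3); first by lra.
by apply: (nondentable_hull nC) => //; [exact: subset_hull|lra].
Qed.

Section bush.
Context {R : realType} {K : numFieldType} (s : scalar_field R K).
Context {X : completeNormedModType K}.
Local Notation "`‖ x ‖" := (rnorm s x) (at level 0, x at level 99).

(** [A n] is the level [n] of a bush whose barycentres are only approximate. The errors [c * 2^-n]
    add up to [2 * c], well below the separation [8 * c]. *)
Variables (A : nat -> set X) (c : R).
Hypothesis c0 : 0 < c.
Hypothesis Acomb : forall n x, A n x -> exists l,
  [/\ weighted_in [set z | A n.+1 z /\ 8 * c <= `‖z - x‖] l, weight l = 1 &
      `‖x - comb s l‖ < c * 2^-1 ^+ n].

Let children n x : seq (R * X) :=
  if pselect (A n x) is left Anx then projT1 (cid (Acomb Anx)) else [::].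

Let childrenP n x : A n x ->
  [/\ weighted_in [set z | A n.+1 z /\ 8 * c <= `‖z - x‖] (children n x),
      weight (children n x) = 1 & `‖x - comb s (children n x)‖ < c * 2^-1 ^+ n].
Proof. by rewrite /children; case: pselect => // Anx _; case: cid. Qed.

(** The barycentre of the descendants of [x], a point of level [n], after [k] generations. *)
Fixpoint bush_iter n k x : X :=
  if k is k'.+1 then
    \sum_(p <- children n x) ofR s p.1 *: bush_iter n.+1 k' p.2
  else x.

Let comb_dist_le (l : seq (R * X)) (S : set X) (f g : X -> X) (d : R) :
  weighted_in S l -> weight l = 1 -> (forall z, S z -> `‖f z - g z‖ <= d) ->
  `‖\sum_(p <- l) ofR s p.1 *: f p.2 - \sum_(p <- l) ofR s p.1 *: g p.2‖ <= d.
Proof.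
move=> lS l1 fg; rewrite -sumrB; apply: le_trans (rnorm_sum _ _ _) _.
rewrite -[leRHS]mul1r -l1 /weight mulr_suml big_seq [leRHS]big_seq.
apply: ler_sum => p /lS[p0 Sp]; rewrite -scalerBr rnormZr ger0_norm//.
by rewrite ler_wpM2l// fg.
Qed.

Let bush_iter_step n k x : A n x ->
  `‖bush_iter n k.+1 x - bush_iter n k x‖ <= c * 2^-1 ^+ (n + k).
Proof.
elim: k n x => [|k ih] n x Ax; have [lS l1 lx] := childrenP Ax.
  by rewrite rdistC addn0; exact: ltW.
rewrite [bush_iter n k.+2 x]/= [bush_iter n k.+1 x]/=.
apply: (@comb_dist_le _ _ (bush_iter n.+1 k.+1) _ _ lS l1) => z [Az _].
by have := ih _ _ Az; rewrite addSnnS.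
Qed.

Let bush_iter_dist n k j x : A n x ->
  `‖bush_iter n (k + j) x - bush_iter n k x‖ <=
    2 * c * 2^-1 ^+ (n + k) * (1 - 2^-1 ^+ j).
Proof.
move=> Ax; elim: j => [|j ih].
  by rewrite addn0 subrr rnorm0 expr0 subrr mulr0.
apply: le_trans (rdistD s _ (bush_iter n (k + j) x) _) _.
have := @bush_iter_step n (k + j) x Ax; rewrite addnS exprS addnA exprD.
by lra.
Qed.

Let bush_lim_ex n x : A n x -> exists y, forall k,
  `‖y - bush_iter n k x‖ <= 2 * c * 2^-1 ^+ (n + k).
Proof.
move=> Ax.
have half_ge0 k : 0 <= 2^-1 ^+ k :> R by rewrite exprn_ge0// invr_ge0.
have bd k j : (k <= j)%N ->
    `‖bush_iter n j x - bush_iter n k x‖ <= 2 * c * 2^-1 ^+ (n + k).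
  move=> kj; have := @bush_iter_dist n k (j - k) x Ax; rewrite subnKC//.
  move=> /le_trans; apply; apply: ler_piMr.
    by rewrite mulr_ge0// mulr_ge0// ltW.
  by have := half_ge0 (j - k)%N; lra.
have [e e0|y yP] := @completeP _ _ s X (bush_iter n ^~ x).
  have [N NP] := half_expn_lt (4 * c) e0; exists N => i j Ni Nj.
  apply: le_lt_trans (rdistD s _ (bush_iter n N x) _) _.
  rewrite (rdistC s _ (bush_iter n j x)).
  have := bd _ _ Ni; have := bd _ _ Nj; have := NP (n + N)%N (leq_addl _ _); lra.
exists y => k; apply/ler_addgt0Pr => e e0; have [N NP] := yP e e0.
apply: le_trans (rdistD s _ (bush_iter n (maxn N k) x) _) _.
have := NP _ (leq_maxl N k); have := bd _ _ (leq_maxr N k); lra.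
Qed.

(* A point of [A n] is only an approximate barycentre of distant points of
   [A n.+1]. The limits of the iterated barycentres are exact barycentres of one
   another, and the summable errors keep them distant. *)
Lemma bush_nondentable (M : R) : (forall n x, A n x -> `‖x‖ <= M) ->
  A 0 !=set0 -> exists C : set X, [/\ C !=set0,
    forall x, C x -> `‖x‖ <= M + 2 * c & nondentable s (4 * c) C].
Proof.
move=> AM [x0 Ax0].
pose lm n x :=
  if pselect (A n x) is left Anx then projT1 (cid (bush_lim_ex Anx)) else 0.
have lmP n x : A n x -> forall k,
    `‖lm n x - bush_iter n k x‖ <= 2 * c * 2^-1 ^+ (n + k).
  by rewrite /lm; case: pselect => // Anx _; case: cid.
have half_le1 k : 2^-1 ^+ k <= 1 :> R by rewrite exprn_ile1 ?invr_ge0 ?invf_le1 ?ler1n.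
have lmx n x : A n x -> `‖lm n x - x‖ <= 2 * c.
  move=> Ax; apply: le_trans (lmP n x Ax 0) _; rewrite ler_piMr//.
  by rewrite mulr_ge0// ltW.
have lm_comb n x : A n x ->
    lm n x = \sum_(p <- children n x) ofR s p.1 *: lm n.+1 p.2.
  move=> Ax; have [lS l1 _] := childrenP Ax.
  apply/subr0_eq/(rnorm0_eq0 (s := s))/eqP; rewrite eq_le rnorm_ge0 andbT.
  apply/ler_addgt0Pr => e e0; rewrite add0r.
  have [N NP] := half_expn_lt (4 * c) e0.
  apply: le_trans (rdistD s _ (bush_iter n N.+1 x) _) _.
  have h1 := lmP _ _ Ax N.+1.
  have h2 : `‖bush_iter n N.+1 x - \sum_(p <- children n x) ofR s p.1 *: lm n.+1 p.2‖
      <= 2 * c * 2^-1 ^+ (n.+1 + N).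
    apply: (@comb_dist_le _ _ (bush_iter n.+1 N) _ _ lS l1) => z [Az _].
    by rewrite rdistC lmP.
  have := NP (n + N.+1)%N; rewrite addnS leqW ?leq_addl// => /(_ isT).
  by move: h1 h2; rewrite addnS addSn; lra.
exists [set y | exists n x, A n x /\ y = lm n x]; split.
- by exists (lm 0%N x0), 0%N, x0.
- move=> _ [n [x [Ax ->]]]; have := rnormD s (lm n x - x) x; rewrite subrK.
  have := lmx _ _ Ax; have := AM _ _ Ax; lra.
- move=> _ [n [x [Ax ->]]]; have [lS l1 _] := childrenP Ax.
  rewrite {2}lm_comb//.
  have := @convex_comb _ _ s X _ [seq (p.1, lm n.+1 p.2) | p <- children n x]
    (@convex_hull _ X _).
  rewrite /comb big_map; apply; last by rewrite -l1 /weight big_map.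
  move=> _ /mapP[p /lS[p0 [Ap pd]] ->]; split => //=.
  apply: subset_hull; split; first by exists n.+1, p.2.
  (* Passing to limits moves both [x] and its child by at most [2 * c], which leaves [4 * c] of the
     separation [8 * c]. *)
  have := rdistD s p.2 (lm n.+1 p.2) x; have := rdistD s (lm n.+1 p.2) (lm n x) x.
  have := lmx _ _ Ax; have := lmx _ _ Ap; rewrite (rdistC s (lm n.+1 p.2) p.2); lra.
Qed.

End bush.

(** * Stegall's variational principle *)

Lemma near_sup (R : realType) (T : Type) (C : set T) (f : T -> R) (b e : R) :
    C !=set0 -> (forall x, C x -> f x <= b) -> 0 < e ->
  exists2 w, C w & forall z, C z -> f z <= f w + e.
Proof.
move=> C0 fb e0; have hf : has_sup [set f x | x in C].
  split; first by case: C0 => x Cx; exists (f x), x.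
  by exists b => _ [x Cx <-]; exact: fb.
have [_ [w Cw <-] we] := sup_adherent e0 hf; exists w => // z Cz.
have : f z <= sup [set f x | x in C] by apply: ub_le_sup; [case: hf|exists z].
by lra.
Qed.

Section stegall.
Context {R : realType} {K : numFieldType} (s : scalar_field R K).
Context {X : completeNormedModType K}.
Local Notation "`‖ x ‖" := (rnorm s x) (at level 0, x at level 99).
Hypothesis rnpX : radon_nikodym_property X.
Variables (C : set X) (M : R).
Hypotheses (C0 : C !=set0) (CM : forall x, C x -> `‖x‖ <= M).

Let h : R := 2^-1.

(* If no such slice exists, the near maximizers [A n] of [phi + g], for [g] of
   norm at most [e * (1 - h ^+ n)], form a bush: the norm of [g] may grow by
   [u = e * h ^+ n.+1] in any direction, while near maximality is only lost up
   to [t * (h ^+ n * h ^+ n)], which is small compared to [u]. *)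
Lemma small_slice (phi : X -> R) (b e d : R) :
    (forall x, C x -> phi x <= b) -> 0 < e -> 0 < d ->
  exists g c x w, [/\ real_linear s g, forall y, g y <= e * `‖y‖, C w,
    c < phi w + g w & forall z, C z -> c <= phi z + g z -> `‖z - x‖ <= d].
Proof.
move=> phib e0 d0; apply: contrapT => nsmall.
have far g c x w : real_linear s g -> (forall y, g y <= e * `‖y‖) -> C w ->
    c < phi w + g w -> exists z, [/\ C z, c <= phi z + g z & d < `‖z - x‖].
  move=> gl ge Cw cw; apply: contrapT => nz; apply: nsmall.
  exists g, c, x, w; split => // z Cz cz; rewrite leNgt; apply/negP => dz.
  by apply: nz; exists z.
have h_ge0 k : 0 <= h ^+ k by rewrite exprn_ge0// invr_ge0.
have h_gt0 k : 0 < h ^+ k by rewrite exprn_gt0// invr_gt0.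
have h_le1 k : h ^+ k <= 1 by rewrite exprn_ile1 ?invr_ge0 ?invf_le1 ?ler1n.
(* The separation [8 * k] of the bush is [d]. With this [t], the two losses [t * h ^+ (2 * n)] and
   [t * h ^+ (2 * n + 2)] of near maximality stay below [u * (k * h ^+ n)]. *)
pose k := d / 8; have k0 : 0 < k by rewrite divr_gt0.
pose t := k * e / 8; have t0 : 0 < t by rewrite divr_gt0// mulr_gt0.
pose A n := [set x | C x /\ exists g, [/\ real_linear s g,
  forall y, g y <= e * (1 - h ^+ n) * `‖y‖ &
  forall z, C z -> phi z + g z <= phi x + g x + t * (h ^+ n * h ^+ n)]].
have M0 : 0 <= M by case: C0 => x /CM; apply: le_trans; exact: rnorm_ge0.
have bdd n g : (forall y, g y <= e * (1 - h ^+ n) * `‖y‖) ->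
    forall x, C x -> phi x + g x <= b + e * M.
  move=> ge x Cx; apply: lerD; first exact: phib.
  apply: le_trans (ge x) _; rewrite -mulrA; apply: ler_wpM2l; first exact: ltW.
  apply: le_trans _ (CM Cx); rewrite ler_piMl ?rnorm_ge0//.
  by have := h_ge0 n; lra.
have Acomb n x : A n x -> exists l,
  [/\ weighted_in [set z | A n.+1 z /\ 8 * k <= `‖z - x‖] l, weight l = 1 &
      `‖x - comb s l‖ < k * 2^-1 ^+ n].
  move=> [Cx [g [gl ge gx]]]; apply: near_convex_hull => f fl fn.
  pose u := e * h ^+ n.+1; have u0 : 0 < u by rewrite mulr_gt0.
  (* The test functional [f] tilts [g]. The far point [z] nearly maximizes [phi + g - u * f] while
     [x] nearly maximizes [phi + g]; the difference of the two bounds controls [u * (f z - f x)]. *)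
  pose g' y := g y - u * f y.
  have g'l : real_linear s g'.
    split=> [y z|a y]; rewrite /g' ?gl.1 ?gl.2 ?fl.1 ?fl.2; ring.
  have g'n y : g' y <= e * (1 - h ^+ n.+1) * `‖y‖.
    have := fn (- y); rewrite (real_linearN _ fl) rnormN => fy.
    have := ge y; rewrite /g'; have : u * - f y <= u * `‖y‖ by rewrite ler_wpM2l// ltW.
    by rewrite /u exprS /h; lra.
  pose v := t * (h ^+ n.+1 * h ^+ n.+1).
  have v0 : 0 < v by rewrite !mulr_gt0.
  have [w Cw wmax] := near_sup C0 (bdd _ _ g'n) (divr_gt0 v0 (ltr0Sn _ 1)).
  have [||||z [Cz cz dz]] := far g' (phi w + g' w - v / 2) x w => //.
  - move=> y; apply: le_trans (g'n y) _; rewrite ler_wpM2r ?rnorm_ge0//.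
    by rewrite ler_piMr ?ltW// gtrBl.
  - by lra.
  exists z.
    split; last by rewrite /k; lra.
    split => //; exists g'; split => // z' Cz'.
    by have := wmax _ Cz'; rewrite -/v; lra.
  have := gx _ Cz; have := wmax _ Cx.
  rewrite -/(h ^+ n) /g' in cz *.
  have -> : k * 2^-1 ^+ n = 2 * k * h ^+ n.+1 by rewrite exprS /h; field.
  move=> i1 i2; have i3 : u * (f z - f x) <= t * (h ^+ n * h ^+ n) + v by lra.
  have i4 : t * (h ^+ n * h ^+ n) + v < u * (2 * k * h ^+ n.+1).
    rewrite /v /u !exprS /t /h; set hn := 2^-1 ^+ n.
    have hh : 0 < k * e * (hn * hn) by rewrite !mulr_gt0 /hn.
    by lra.
  by have := le_lt_trans i3 i4; rewrite ltr_pM2l.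
have [||D [D0 DM]] := @bush_nondentable _ _ s X A k k0 Acomb M.
- by move=> n x [/CM].
- have [w Cw wmax] := near_sup C0 phib t0; exists w; split => //.
  exists (fun=> 0); split.
  + by split=> *; rewrite ?addr0 ?mulr0.
  + by move=> y; rewrite expr0 subrr mulr0 mul0r.
  + by move=> z /wmax; rewrite expr0 !addr0 mulr1 mulr1.
by apply: (rnp_nondentable rnpX D0 DM); rewrite mulr_gt0.
Qed.

End stegall.

Lemma dependent_sequence (T : Type) (P : nat -> T -> Prop)
    (Q : nat -> T -> T -> Prop) (t0 : T) : P 0 t0 ->
    (forall n t, P n t -> exists2 t', P n.+1 t' & Q n t t') ->
  exists u : nat -> T, u 0 = t0 /\ forall n, P n (u n) /\ Q n (u n) (u n.+1).
Proof.
move=> P0 step.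
pose next n (t : {t | P n t}) : {t' | P n.+1 t'} :=
  let: exist2 t' Pt' _ := cid2 (step n _ (svalP t)) in exist _ t' Pt'.
have nextQ n t : Q n (sval t) (sval (next n t)).
  by rewrite /next; case: cid2.
pose u := fix u n : {t | P n t} :=
  if n is k.+1 then next k (u k) else exist _ t0 P0.
by exists (fun n => sval (u n)); split => // n; split; [exact: svalP|exact: nextQ].
Qed.

Section stegall_principle.
Context {R : realType} {K : numFieldType} (s : scalar_field R K).
Context {X : completeNormedModType K}.
Local Notation "`‖ x ‖" := (rnorm s x) (at level 0, x at level 99).
Hypothesis rnpX : radon_nikodym_property X.
Variables (C : set X) (M : R).
Hypotheses (C0 : C !=set0) (CM : forall x, C x -> `‖x‖ <= M) (cC : closed C).

Let h : R := 2^-1.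
Let h_ge0 k : 0 <= h ^+ k. Proof. by rewrite exprn_ge0// invr_ge0. Qed.
Let h_gt0 k : 0 < h ^+ k. Proof. by rewrite exprn_gt0// invr_gt0. Qed.
Let h_le1 k : h ^+ k <= 1.
Proof. by rewrite exprn_ile1 ?invr_ge0 ?invf_le1 ?ler1n. Qed.

(** The bounds on the increments telescope to [e * (h ^+ n - h ^+ (n + k))]: this gives pointwise
    Cauchy sequences and, starting from [f 0 = 0], the bound [e] in the limit. *)
Lemma real_linear_limit (f : nat -> X -> R) (e : R) : 0 < e ->
    (forall n, real_linear s (f n)) -> f 0 = (fun=> 0) ->
    (forall n y, f n.+1 y - f n y <= e * h ^+ n.+1 * `‖y‖) ->
  exists F, [/\ real_linear s F, forall y, F y <= e * `‖y‖ &
    forall y d, 0 < d -> exists N, forall n, (N <= n)%N -> `|F y - f n y| < d].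
Proof.
move=> e0 fl f0 fS.
have fD n k y : f (n + k)%N y - f n y <= e * (h ^+ n - h ^+ (n + k)) * `‖y‖.
  elim: k => [|k ih]; first by rewrite addn0 !subrr mulr0 mul0r.
  by have := fS (n + k)%N y; move: ih; rewrite addnS exprS /h; lra.
have fN n k y : `|f (n + k)%N y - f n y| <= e * `‖y‖ * h ^+ n.
  have fDn y' : f (n + k)%N y' - f n y' <= e * `‖y'‖ * h ^+ n.
    apply: le_trans (fD n k y') _; rewrite -mulrA -mulrA; apply: ler_wpM2l.
      exact: ltW.
    by rewrite mulrC ler_wpM2l ?rnorm_ge0// gerBl.
  rewrite ler_norml fDn andbT lerNl opprB.
  by have := fDn (- y); rewrite !(real_linearN _ (fl _)) rnormN; lra.
have cvgf y : cvg (f ^~ y @ \oo).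
  apply/cauchy_cvgP/cauchy_exP => d d0.
  have [N NP] := half_expn_lt (e * `‖y‖) d0; exists (f N y), N => // n /= Nn.
  rewrite /ball/= distrC -(subnKC Nn); apply: le_lt_trans (fN _ _ _) _.
  exact: NP.
pose F y : R := lim (f ^~ y @ \oo).
have FP y (d : R) : 0 < d -> exists N, forall n, (N <= n)%N -> `|F y - f n y| < d.
  move=> d0; have [N _ NP] := (cvgrPdist_lt _ _).1 (cvgf y) d d0.
  by exists N => n /NP.
exists F; split => //.
  split=> [x y|a x].
    rewrite /F -limD//; congr (lim (_ @ \oo)).
    by apply/funext => n; rewrite (fl n).1.
  apply: cvg_lim => //; have -> : f ^~ (ofR s a *: x) = (fun n => a * f n x).
    by apply/funext => n; rewrite (fl n).2.
  exact: cvgM (cvg_cst a) (cvgf x).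
move=> y; apply/ler_addgt0Pr => d d0; have [N NP] := FP y d d0.
have := NP _ (leqnn N); rewrite ltr_norml => /andP[_].
have := fD 0%N N y; rewrite f0 add0n subr0 expr0 => i1.
have := rnorm_ge0 s y; have := h_ge0 N => i2 i3.
have : 0 <= e * h ^+ N * `‖y‖ by rewrite !mulr_ge0// ltW.
by lra.
Qed.

(** Nested slices [c n <= phi + f n] of [C], with diameters tending to 0, shrink to a point [x]. If
    [z] did better than [x] for the limit [F] of the [f n], then [z] would lie in every late slice
    along with [x], hence be equal to [x]. *)
Lemma stegall_variational (phi : X -> R) (b e : R) :
    (forall x, C x -> phi x <= b) ->
    (forall x y, phi x <= phi y + `‖x - y‖) -> 0 < e ->
  exists f x, [/\ real_linear s f, forall y, f y <= e * `‖y‖, C x &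
    forall z, C z -> phi z + f z <= phi x + f x].
Proof.
move=> phib phiL e0.
have M0 : 0 <= M by case: C0 => x /CM; apply: le_trans; exact: rnorm_ge0.
(* [M] may be 0, while the radii of the slices and the divisor of [t] must be positive. *)
pose M' := M + 1; have M'0 : 0 < M' by rewrite ltr_wpDl.
have CM' x : C x -> `‖x‖ <= M' by move/CM; rewrite /M'; lra.
pose P n (t : (X -> R) * R * X) := let: (f, c, w) := t in
  [/\ real_linear s f, exists a, forall y, f y <= a * `‖y‖, C w, c < phi w + f w &
    forall z z', C z -> C z' -> c <= phi z + f z -> c <= phi z' + f z' ->
      `‖z - z'‖ <= 2 * M' * h ^+ n].
pose Q n (t t' : (X -> R) * R * X) := let: (f, c, w) := t in
  let: (f', c', w') := t' in
  (forall y, f' y - f y <= e * h ^+ n.+1 * `‖y‖) /\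
  forall z, C z -> c' <= phi z + f' z -> c <= phi z + f z.
have [w0 Cw0] := C0.
have [||u [u0 uP]] := @dependent_sequence _ P Q (fun=> 0, phi w0 - 1, w0).
- split => //.
  + by split=> *; rewrite ?addr0 ?mulr0.
  + by exists 0 => y; rewrite mul0r.
  + by rewrite addr0 gtrBl.
  + move=> z z' /CM' zM /CM' z'M _ _; rewrite expr0 mulr1.
    by have := rnormB s z z'; lra.
- move=> n [[f c] w] [fl [a fa] Cw cw diam].
  (* The choice of [e'] makes [g] at most [t] in modulus on [C]. A point above the level [c1] thus
     loses at most [3 * t] against [phi w + f w], and stays above [c]. *)
  pose t := (phi w + f w - c) / 4; have t0 : 0 < t by rewrite divr_gt0// subr_gt0.
  pose e' := Num.min (e * h ^+ n.+1) (t / M').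
  have e'0 : 0 < e' by rewrite lt_min mulr_gt0//= divr_gt0.
  have fb x : C x -> phi x + f x <= b + `|a| * M'.
    move=> Cx; apply: lerD; first exact: phib.
    apply: le_trans (fa x) _; apply: (@le_trans _ _ (`|a| * `‖x‖)).
      by rewrite ler_wpM2r ?rnorm_ge0// ler_norm.
    by rewrite ler_wpM2l// CM'.
  have [g [c' [x [w' [gl ge Cw' cw' dx]]]]] := small_slice rnpX C0 CM fb e'0
    (mulr_gt0 M'0 (h_gt0 n.+1)).
  have gt z : C z -> `|g z| <= t.
    move=> Cz; have e't : e' * `‖z‖ <= t.
      apply: (@le_trans _ _ (t / M' * M')); last by rewrite divfK// gt_eqF.
      apply: ler_pM; rewrite ?rnorm_ge0 ?CM'//; first exact: ltW.
      by rewrite ge_min lexx orbT.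
    have := ge (- z); rewrite rnormN (real_linearN _ gl) => gNz.
    rewrite ler_norml; have := ge z; lra.
  pose f' y := f y + g y; pose c1 := phi w + f' w - t.
  have f'l : real_linear s f'.
    by split=> [y z|k y]; rewrite /f' ?fl.1 ?fl.2 ?gl.1 ?gl.2; ring.
  have f'a y : f' y <= (a + e') * `‖y‖.
    by rewrite /f' mulrDl lerD.
  have small z z' : C z -> C z' -> c' <= phi z + f' z -> c' <= phi z' + f' z' ->
      `‖z - z'‖ <= 2 * M' * h ^+ n.+1.
    move=> Cz Cz' cz cz'; have := rdistD s z x z'; rewrite (rdistC s x z').
    have := dx z Cz; have := dx z' Cz'; rewrite !addrA in cz cz' *.
    by move=> /(_ cz') ? /(_ cz); lra.
  have f'e y : f' y - f y <= e * h ^+ n.+1 * `‖y‖.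
    rewrite /f' addrAC subrr add0r; apply: le_trans (ge y) _.
    by rewrite ler_wpM2r ?rnorm_ge0// ge_min lexx.
  have nest z : C z -> c1 <= phi z + f' z -> c <= phi z + f z.
    move=> Cz; have := gt z Cz; have := gt w Cw; rewrite !ler_norml /c1 /f' /t.
    by move=> /andP[? ?] /andP[? ?]; lra.
  (* The higher level is kept: [c'] makes the slice small and [c1] puts it inside the previous one.
     Accordingly [w] or [w'] lies strictly above it. *)
  have [c'c1|c1c'] := leP c' c1.
    exists (f', c1, w); last by [].
    split => //; first by exists (a + e').
      by rewrite /c1; lra.
    move=> z z' Cz Cz' cz cz'; apply: small => //.
      exact: le_trans cz.
    exact: le_trans cz'.
  exists (f', c', w').
    split => //; first by exists (a + e').
    by rewrite /f' addrA.
  by split => // z Cz cz; apply: nest => //; apply: le_trans cz; exact: ltW.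
pose f n := (u n).1.1; pose c n := (u n).1.2; pose w n := (u n).2.
have fl n : real_linear s (f n).
  by have [+ _] := uP n; rewrite /P /f; case: (u n) => [[? ?] ?] [].
have Cw n : C (w n).
  by have [+ _] := uP n; rewrite /P /w; case: (u n) => [[? ?] ?] [].
have cw n : c n <= phi (w n) + f n (w n).
  have [+ _] := uP n; rewrite /P /w /f /c; case: (u n) => [[? ?] ?] [_ _ _ + _].
  exact: ltW.
have diam n z z' : C z -> C z' -> c n <= phi z + f n z ->
    c n <= phi z' + f n z' -> `‖z - z'‖ <= 2 * M' * h ^+ n.
  have [+ _] := uP n; rewrite /P /f /c; case: (u n) => [[? ?] ?] [_ _ _ _ +].
  exact.
have fS n y : f n.+1 y - f n y <= e * h ^+ n.+1 * `‖y‖.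
  have [_] := uP n; rewrite /Q /f; case: (u n) => [[? ?] ?].
  by case: (u n.+1) => [[? ?] ?] [].
have nest n z : C z -> c n.+1 <= phi z + f n.+1 z -> c n <= phi z + f n z.
  have [_] := uP n; rewrite /Q /f /c; case: (u n) => [[? ?] ?].
  by case: (u n.+1) => [[? ?] ?] [_]; exact.
have nests n k z : C z -> c (n + k)%N <= phi z + f (n + k)%N z ->
    c n <= phi z + f n z.
  by move=> Cz; elim: k => [|k ih]; rewrite ?addn0// addnS => /(nest _ _ Cz).
have f0 : f 0%N = (fun=> 0) by rewrite /f u0.
have [F [Fl Fe FP]] := real_linear_limit e0 fl f0 fS.
have win n m : (n <= m)%N -> c n <= phi (w m) + f n (w m).
  by move=> /subnKC nm; apply: (nests n (m - n)%N); rewrite ?nm.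
have [d d0|x xP] := @completeP _ _ s X w.
  have [N NP] := half_expn_lt (2 * M') d0; exists N => m n Nm Nn.
  apply: le_lt_trans (NP N (leqnn N)).
  by apply: diam => //; exact: win.
have Cx : C x.
  apply/(closedP s C).1 => // d d0; have [N NP] := xP d d0.
  by exists (w N) => //; exact: NP.
have fa n : exists a, forall y, f n y <= a * `‖y‖.
  by have [+ _] := uP n; rewrite /P /f; case: (u n) => [[? ?] ?] [].
(* The slice [n] contains all later [w m]; it is closed in [C], since [phi] is Lipschitz and [f n]
   is bounded. *)
have xin n : c n <= phi x + f n x.
  have [a fna] := fa n; apply/ler_addgt0Pr => d d0.
  have a1 : 0 < `|a| + 1 by rewrite ltr_wpDl.
  have [N NP] := xP (d / (`|a| + 1)) (divr_gt0 d0 a1).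
  have := NP _ (leq_maxl N n); rewrite ltr_pdivlMr//.
  set y := w _ => xy; have := win _ _ (leq_maxr N n); rewrite -/y => cy.
  have := phiL y x; have := fna (y - x).
  rewrite (real_linearB _ _ (fl n)) (rdistC s y x).
  have : a * `‖x - y‖ <= `|a| * `‖x - y‖ by rewrite ler_wpM2r ?rnorm_ge0// ler_norm.
  by lra.
exists F, x; split => // z Cz; rewrite leNgt; apply/negP => zx.
pose d := (phi z + F z - (phi x + F x)) / 2.
have d0 : 0 < d by rewrite divr_gt0// subr_gt0.
have [N1 N1P] := FP z d d0; have [N2 N2P] := FP x d d0.
suff xz : `‖x - z‖ <= 0.
  have /(rnorm0_eq0 (s := s))/subr0_eq xzE : `‖x - z‖ = 0.
    by apply/eqP; rewrite eq_le xz rnorm_ge0.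
  by move: zx; rewrite xzE ltxx.
apply/ler_addgt0Pr => k k0; rewrite add0r.
have [N3 N3P] := half_expn_lt (2 * M') k0.
pose N := maxn N1 (maxn N2 N3).
have /N1P : (N1 <= N)%N by rewrite leq_maxl.
have /N2P : (N2 <= N)%N by rewrite /N maxnCA leq_maxl.
have /N3P NN3 : (N3 <= N)%N by rewrite /N maxnA leq_maxr.
rewrite !ltr_norml => /andP[i1 i2] /andP[i3 i4].
apply: le_trans (ltW NN3); apply: diam => //.
by have := xin N; move: i1 i2 i3 i4; rewrite /d; lra.
Qed.

End stegall_principle.

(** * Operators attaining their minimum norm *)

Section hull_image.
Context {R : realType} {K : numFieldType} (s : scalar_field R K).
Context {X Y : normedModType K}.

(** The preimage of a closed convex set by a Lipschitz affine map is closed and convex. Affine maps,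
    and not only linear ones, are needed for translates of a nondentable set. *)
Lemma hull_image (g : X -> Y) (c : R) (A : set X) (B : set Y) :
    (forall x y t, g (ofR s t *: x + ofR s (1 - t) *: y) =
      ofR s t *: g x + ofR s (1 - t) *: g y) ->
    (forall x y, rnorm s (g x - g y) <= c * rnorm s (x - y)) ->
    (forall x, A x -> closed_convex_hull B (g x)) ->
  forall x, closed_convex_hull A x -> closed_convex_hull B (g x).
Proof.
move=> ga gc AB x; apply: (@hull_min _ X _ (g @^-1` closed_convex_hull B)) => //.
  apply/(closedP s) => y yP; move/(closedP s): (@closed_hull _ Y B); apply.
  move=> e e0; have c1 : 0 < `|c| + 1 by rewrite ltr_wpDl.
  have [z Bz yz] := yP _ (divr_gt0 e0 c1); exists (g z) => //.
  apply: le_lt_trans (gc _ _) _.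
  apply: (@le_lt_trans _ _ ((`|c| + 1) * rnorm s (y - z))).
    by rewrite ler_wpM2r ?rnorm_ge0// (le_trans (ler_norm c))// lerDl.
  by rewrite mulrC -ltr_pdivlMr.
apply/(convexP s) => y z t By Bz t01; rewrite /preimage/= ga.
by move/(convexP s): (@convex_hull _ Y B); apply.
Qed.

End hull_image.

Section minimum_attaining_density.
Context {R : realType} {K : numFieldType} (s : scalar_field R K).
Context {X Y : normedModType K}.
Local Notation "`‖ x ‖" := (rnorm s x) (at level 0, x at level 99).
Variable T : {linear X -> Y}.

Definition bounded_below := exists2 a, 0 < a & forall x, a * `‖x‖ <= `‖T x‖.

Lemma attains_min_norm_zero x : x != 0 -> T x = 0 -> attains_min_norm T.
Proof.
move=> x0 Tx; apply/(attains_min_normP s); exists (ofR s `‖x‖^-1 *: x).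
  by rewrite rnormZr gtr0_norm ?invr_gt0 ?mulVf ?gt_eqF ?rnorm_gt0.
by move=> z _; rewrite linearZ/= Tx scaler0 rnorm0 rnorm_ge0.
Qed.

End minimum_attaining_density.

Section rank_one_perturbations.
Context {R : realType} {K : numFieldType} (s : scalar_field R K).
Context {X Y : normedModType K}.
Local Notation "`‖ x ‖" := (rnorm s x) (at level 0, x at level 99).

Lemma MA_dist (T S : {linear X -> Y}) (c e : R) :
    bounded_operator T -> attains_min_norm S -> 0 <= c -> c < e ->
    (forall x, `‖S x - T x‖ <= c * `‖x‖) ->
  exists2 S : {linear X -> Y}, MA X Y S & op_norm (S \- T) < ofR s e.
Proof.
move=> /(bounded_operatorP s)[b b0 Tb] mS c0 ce ST; exists S; last first.
  exact: op_norm_lt ce ST.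
split => //; apply/(bounded_operatorP s); exists (c + b); first exact: addr_ge0.
move=> x; rewrite mulrDl -[S x](subrK (T x)); apply: le_trans (rnormD _ _ _) _.
by rewrite lerD.
Qed.

Lemma MA_approx_not_below (T : {linear X -> Y}) (e : R) : 0 < e ->
    bounded_operator T -> ~ bounded_below s T ->
  exists2 S : {linear X -> Y}, MA X Y S & op_norm (S \- T) < ofR s e.
Proof.
move=> e0 bT nT; have [x Tx] : exists x, `‖T x‖ < e / 2 * `‖x‖.
  apply: contrapT => /forallNP Tx; apply: nT; exists (e / 2); first by rewrite divr_gt0.
  by move=> x; rewrite leNgt; apply/negP.
have nx : 0 < `‖x‖.
  rewrite lt_def rnorm_ge0 andbT; apply: contraTneq Tx => ->.
  by rewrite mulr0 -leNgt rnorm_ge0.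
have [h [hl hn hx]] := norming_functional s x.
have [|f [fh fn]] := extend_bounded_functional (c := 1) hl.
  by move=> y; rewrite mul1r.
have fx : `‖x‖ <= modulus s (f x) by rewrite -hx -fh re_le_modulus.
have fx0 : f x != 0.
  by apply: contraTneq nx => fx0; rewrite -leNgt (le_trans fx)// fx0 /modulus normr0 re0.
(* As [f] norms [x], [|f z / f x| <= |z| / |x|], so the perturbation has norm at most
   [|T x| / |x| < e / 2]. *)
pose S0 z := T z - (f z / f x) *: T x.
have S0l : linear S0.
  move=> a u v; rewrite /S0 !linearP/= mulrDl scalerDl scalerBr scalerA -mulrA.
  by rewrite opprD addrACA.
apply: (@MA_dist _ (linear_of S0l) (`‖T x‖ / `‖x‖)) => //.
- apply: (@attains_min_norm_zero _ _ s _ _ _ x).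
    by apply: contraTneq nx => ->; rewrite rnorm0 ltxx.
  by rewrite linear_ofE /S0 mulfV// scale1r subrr.
- by rewrite divr_ge0 ?rnorm_ge0.
- rewrite ltr_pdivrMr//; apply: lt_le_trans Tx _.
  by rewrite ler_wpM2r ?rnorm_ge0//; lra.
- move=> z; rewrite linear_ofE /S0 addrAC subrr add0r rnormN rnormZ modulusM.
  have := fn z; rewrite mul1r => fz.
  have -> : modulus s (f x)^-1 = (modulus s (f x))^-1.
    apply/(mulfI (x := modulus s (f x))); first by rewrite gt_eqF// (lt_le_trans nx).
    by rewrite -modulusM !mulfV ?modulus1// gt_eqF// (lt_le_trans nx).
  rewrite [leRHS]mulrAC [leRHS]mulrC mulrA [leRHS]mulrAC ler_wpM2r ?rnorm_ge0//.
  rewrite [leRHS]mulrC; apply: ler_pM; rewrite ?invr_ge0 ?modulus_ge0//.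
  by rewrite lef_pV2 ?posrE// (lt_le_trans nx).
Qed.

End rank_one_perturbations.

Section rnp_density.
Context {R : realType} {K : numFieldType} (s : scalar_field R K).
Context {X : completeNormedModType K}.
Local Notation "`‖ x ‖" := (rnorm s x) (at level 0, x at level 99).

(** A set nondentable at scale [e] has an image nondentable at scale [a * e]. The image may fail to
    be closed, whence the use of [rnp_nondentable]. *)
Lemma rnp_bounded_below (Y : completeNormedModType K) (T : {linear X -> Y}) :
    bounded_operator T -> bounded_below s T -> radon_nikodym_property Y ->
  radon_nikodym_property X.
Proof.
move=> /(bounded_operatorP s)[b b0 Tb] [a a0 aT] rnpY C [x0 Cx0] _.
move=> /(bounded_setP s)[M CM]; apply: contrapT => /(not_dentableP s)[e e0 nC].
apply: (@rnp_nondentable _ _ s Y (T @` C) (a * e) (b * M) rnpY).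
- by exists (T x0), x0.
- by move=> _ [x Cx <-]; apply: le_trans (Tb x) _; rewrite ler_wpM2l// CM.
- exact: mulr_gt0.
move=> _ [x Cx <-]; apply: (hull_image (s := s) (c := b) _ _ _ (nC x Cx)).
- by move=> y z t; rewrite linearD !linearZ.
- by move=> y z; rewrite -linearB.
move=> z [Cz ez]; apply: subset_hull; split; first by exists z.
by rewrite -linearB; apply: le_trans (aT _); rewrite ler_wpM2l// ltW.
Qed.

Lemma MA_approx_below (Y : normedModType K) (T : {linear X -> Y}) (e : R) :
    0 < e -> nonzero_space X -> radon_nikodym_property X ->
    bounded_operator T -> bounded_below s T ->
  exists2 S : {linear X -> Y}, MA X Y S & op_norm (S \- T) < ofR s e.
Proof.
move=> e0 [y y0] rnpX bT [a a0 aT]; have [c c0 Tc] := (bounded_operatorP s T).1 bT.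
pose C := [set x | `‖T x‖ <= 1].
have C0 : C !=set0 by exists 0; rewrite /C/= linear0 rnorm0.
have CM x : C x -> `‖x‖ <= a^-1.
  rewrite /C/= => Tx; rewrite -[leRHS]mul1r ler_pdivlMr// mulrC.
  exact: le_trans (aT x) Tx.
have cC : closed C.
  apply/(closedP s) => x xC; rewrite /C/=; apply/ler_addgt0Pr => d d0.
  have c1 : 0 < c + 1 by rewrite ltr_wpDl.
  have [z Tz] := xC (d / (c + 1)) (divr_gt0 d0 c1); rewrite ltr_pdivlMr// => xz.
  have := rnormD s (T z) (T (x - z)); rewrite -linearD addrC subrK.
  have := Tc (x - z); have := rnorm_ge0 s (x - z); move: Tz; rewrite /C/=; lra.
(* The bound [2^-1] makes [1 + f u] invertible for a unit vector [u], with inverse of modulus at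
   most 2; the other one makes the perturbation bound [2 * e' * c] smaller than [e]. *)
pose e' := Num.min 2^-1 (e / (4 * c + 4)).
have e'0 : 0 < e' by rewrite lt_min invr_gt0 ltr0n/= divr_gt0//; lra.
have e'2 : e' <= 2^-1 by rewrite ge_min lexx.
have e'c : e' * (4 * c + 4) <= e.
  by rewrite -ler_pdivlMr ?ge_min ?lexx ?orbT//; lra.
have phiL (x z : X) : `‖x‖ <= `‖z‖ + `‖x - z‖.
  by have := rnormD s z (x - z); rewrite addrC subrK.
have [h [x0 [hl he Cx0 hmax]]] := stegall_variational rnpX C0 CM cC CM phiL e'0.
have [f [fh fe]] := extend_bounded_functional hl he.
(* [C] is invariant under unimodular scalars, so [re (f z)] may be replaced by [|f z|]. *)
have fmax z : C z -> `‖z‖ + modulus s (f z) <= `‖x0‖ + re s (f x0).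
  move=> Cz; have [k k1 kf] := unimodular_mul s (f z).
  have := hmax (k *: z); rewrite -!fh linearZ/= [k *: f z]kf ofRK rnormZ k1 mul1r.
  by apply; rewrite /C/= linearZ/= rnormZ k1 mul1r.
have scaleC z : z != 0 -> C (ofR s `‖T z‖^-1 *: z) /\ 0 < `‖T z‖.
  move=> z0; have Tz : 0 < `‖T z‖.
    by apply: lt_le_trans (aT z); rewrite mulr_gt0// rnorm_gt0.
  by rewrite /C/= linearZ/= rnormZr gtr0_norm ?invr_gt0// mulVf// gt_eqF.
(* The homogeneous form of the maximality of [x0]. *)
have fmaxT z : `‖z‖ + modulus s (f z) <= `‖T z‖ * (`‖x0‖ + re s (f x0)).
  have [->|z0] := eqVneq z 0.
    by rewrite !linear0 /modulus normr0 re0 !rnorm0 mul0r addr0.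
  have [Cz Tz] := scaleC z z0; have := fmax _ Cz.
  rewrite linearZ/= rnormZr [modulus _ _]modulusM modulus_ofR -mulrDr.
  by rewrite gtr0_norm ?invr_gt0// mulrC ler_pdivrMr// mulrC.
have x0_gt0 : 0 < `‖x0‖.
  rewrite lt_def rnorm_ge0 andbT; apply/eqP => /rnorm0_eq0 x00.
  have := fmaxT y; rewrite x00 linear0 re0 rnorm0 addr0 mulr0.
  by have := rnorm_gt0 s y0; have := modulus_ge0 s (f y); lra.
pose u := ofR s `‖x0‖^-1 *: x0.
have u1 : `‖u‖ = 1 by rewrite rnormZr gtr0_norm ?invr_gt0// mulVf// gt_eqF.
have fu : modulus s (f u) <= 2^-1 by apply: le_trans (fe u) _; rewrite u1 mulr1.
pose k := 1 + f u; have k2 : 2^-1 <= modulus s k.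
  by have := modulusD s k (- f u); rewrite /k addrK modulus1 modulusN; lra.
have k0 : k != 0.
  by apply: contraTneq k2 => ->; rewrite /modulus normr0 re0 -ltNge invr_gt0.
have kV : modulus s k^-1 <= 2.
  have : modulus s k * modulus s k^-1 = 1 by rewrite -modulusM mulfV// modulus1.
  by have := modulus_ge0 s k^-1; nra.
pose S0 z := T z - (f z / k) *: T u.
have S0l : linear S0.
  move=> b v w; rewrite /S0 !linearP/= mulrDl scalerDl scalerBr scalerA -mulrA.
  by rewrite opprD addrACA.
(* [V] is the inverse of the rank one perturbation [U] of the identity, by the Sherman-Morrison
   formula with [k = 1 + f u]. *)
pose U z := z + f z *: u; pose V z := z - (f z / k) *: u.
have S0V z : S0 z = T (V z) by rewrite /V linearB linearZ.
have fZ b v : f (b *: v) = b * f v by rewrite linearZ.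
have UV z : U (V z) = z.
  rewrite /U /V linearB fZ -addrA -scaleNr -scalerDl.
  suff -> : - (f z / k) + (f z - f z / k * f u) = 0 by rewrite scale0r addr0.
  by rewrite /k; field; rewrite -/k.
have VU z : V (U z) = z.
  rewrite /U /V linearD fZ -addrA -scaleNr -scalerDl.
  suff -> : f z - (f z + f z * f u) / k = 0 by rewrite scale0r addr0.
  by rewrite /k; field; rewrite -/k.
have Ux0 : `‖x0‖ + re s (f x0) <= `‖U x0‖.
  have -> : U x0 = (1 + f x0 * ofR s `‖x0‖^-1) *: x0.
    by rewrite scalerDl scale1r /U /u scalerA.
  rewrite rnormZ.
  have := re_le_modulus s (1 + f x0 * ofR s `‖x0‖^-1).
  rewrite reD mulrC reM -{1}(rmorph1 (ofR s)) ofRK.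
  rewrite -(ler_pM2r x0_gt0) mulrDl mul1r mulrAC mulVf ?gt_eqF// mul1r.
  by rewrite [ofR _ _ * _]mulrC.
have Ux0_gt0 : 0 < `‖U x0‖.
  by apply: lt_le_trans Ux0; have := fmax _ Cx0; have := modulus_ge0 s (f x0); lra.
apply: (@MA_dist _ _ s X Y T (linear_of S0l) (2 * e' * c)) => //.
(* At the direction of [U x0] the value is at most [1 / |U x0|], since [|T x0| <= 1]. For any unit
   [z], [1 = |U (V z)| <= |V z| + |f (V z)| <= |T (V z)| * |U x0|]. *)
- apply/(attains_min_normP s); exists (ofR s `‖U x0‖^-1 *: U x0).
    by rewrite rnormZr gtr0_norm ?invr_gt0// mulVf// gt_eqF.
  move=> z z1; rewrite linearZ/= S0V VU rnormZr gtr0_norm ?invr_gt0//.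
  apply: (@le_trans _ _ `‖U x0‖^-1).
    by rewrite ler_piMr// invr_ge0 ltW.
  rewrite S0V -[leLHS]mul1r ler_pdivrMr//.
  have := fmaxT (V z).
  have : `‖T (V z)‖ * (`‖x0‖ + re s (f x0)) <= `‖T (V z)‖ * `‖U x0‖.
    by rewrite ler_wpM2l ?rnorm_ge0.
  have := rnormD s (V z) (f (V z) *: u); rewrite -/(U _) UV z1 rnormZ u1 mulr1; lra.
- by rewrite !mulr_ge0// ltW.
- by lra.
- move=> z; rewrite linear_ofE /S0 addrAC subrr add0r rnormN rnormZ modulusM.
  have -> : 2 * e' * c * `‖z‖ = (e' * `‖z‖) * 2 * c by ring.
  apply: ler_pM; rewrite ?mulr_ge0 ?modulus_ge0 ?rnorm_ge0//; last first.
    by apply: le_trans (Tc u) _; rewrite u1 mulr1.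
  by apply: ler_pM; rewrite ?modulus_ge0//; exact: fe.
Qed.

End rnp_density.

(** * Separable reduction of nondentability *)

Section separable_reduction.
Context {R : realType} {K : numFieldType} (s : scalar_field R K).
Context {X : normedModType K}.
Local Notation "`‖ x ‖" := (rnorm s x) (at level 0, x at level 99).
Implicit Types (A C : set X) (l : seq (R * X)).

Lemma hull_approx A x e : closed_convex_hull A x -> 0 < e ->
  exists l, [/\ weighted_in A l, weight l = 1 & `‖x - comb s l‖ < e].
Proof.
move=> Ax; move: x Ax e; pose B := [set x | forall e, 0 < e ->
  exists l, [/\ weighted_in A l, weight l = 1 & `‖x - comb s l‖ < e]].
apply: (@hull_min _ X A B).
- apply/(closedP s) => x xB e e0.
  have [y By xy] := xB _ (divr_gt0 e0 (ltr0Sn _ 1)).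
  have [l [lA l1 yl]] := By _ (divr_gt0 e0 (ltr0Sn _ 1)); exists l; split => //.
  by have := rdistD s x y (comb s l); lra.
- apply/(convexP s) => x y t Bx By /andP[t0 t1] e e0.
  have e2 := divr_gt0 e0 (ltr0Sn R 1).
  have [l [lA l1 xl]] := Bx _ e2; have [m [mA m1 ym]] := By _ e2.
  exists (rescale t l ++ rescale (1 - t) m); split.
  + by move=> p; rewrite mem_cat => /orP[]; apply: weighted_in_rescale; rewrite ?subr_ge0.
  + rewrite /weight big_cat/= -!/(weight _) !weight_rescale l1 m1.
    by rewrite !mulr1 addrC subrK.
  + rewrite /comb big_cat/= -!/(comb s _) !comb_rescale opprD addrACA -!scalerBr.
    apply: le_lt_trans (rnormD _ _ _) _; rewrite !rnormZr !ger0_norm ?subr_ge0//.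
    have : t * `‖x - comb s l‖ <= t * (e / 2) by rewrite ler_wpM2l// ltW.
    have : (1 - t) * `‖y - comb s m‖ <= (1 - t) * (e / 2).
      by rewrite ler_wpM2l ?subr_ge0// ltW.
    by lra.
- move=> x Ax e e0; exists [:: (1, x)]; split.
  + by move=> p; rewrite inE => /eqP ->.
  + by rewrite /weight big_seq1.
  + by rewrite /comb big_seq1 rmorph1 scale1r subrr rnorm0.
Qed.

(** Every point of [C] is, up to [2^-k], a convex combination of finitely many far points. Finite
    words of pairs [(k, i)], where each letter passes to the [i]-th point of the [k]-th combination,
    reach countably many points from [x0], and their set contains all the far points it needs. *)
Lemma countable_nondentable C e : C !=set0 -> nondentable s e C ->
  exists d : nat -> X, (forall n, C (d n)) /\ nondentable s e (range d).
Proof.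
move=> [x0 Cx0] nC.
have chP x k : C x -> exists l, [/\ weighted_in [set z | C z /\ e <= `‖z - x‖] l,
    weight l = 1 & `‖x - comb s l‖ < 2^-1 ^+ k].
  by move=> Cx; apply: hull_approx; [exact: nC|rewrite exprn_gt0// invr_gt0].
pose ch x k := if pselect (C x) is left Cx then projT1 (cid (chP x k Cx)) else [::].
have chS x k : C x -> [/\ weighted_in [set z | C z /\ e <= `‖z - x‖] (ch x k),
    weight (ch x k) = 1 & `‖x - comb s (ch x k)‖ < 2^-1 ^+ k].
  by rewrite /ch; case: pselect => // Cx _; case: cid.
(* An index out of range leaves [x] in place, so that every word leads to a point of [C]. *)
pose child x (p : nat * nat) := (nth (0, x) (ch x p.1) p.2).2.
pose D (t : seq (nat * nat)) := foldl child x0 t.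
pose d n := D (odflt [::] (unpickle n)).
have CD t : C (D t).
  suff : forall x, C x -> C (foldl child x t) by exact.
  elim: t => // p t ih x Cx /=; apply: ih.
  rewrite /child; have [pl|pl] := ltnP p.2 (size (ch x p.1)).
    by have [lC _ _] := chS x p.1 Cx; have [_ []] := lC _ (mem_nth (0, x) pl).
  by rewrite nth_default.
exists d; split => [n|_ [n _ <-]]; first exact: CD.
have /(closedP s) := @closed_hull _ X [set z | range d z /\ e <= `‖z - d n‖].
apply => r r0; have [k kr] := half_expn_lt 1 r0.
have [lC l1 lx] := chS (d n) k (CD _); exists (comb s (ch (d n) k)); last first.
  by apply: lt_trans lx _; have := kr k (leqnn k); rewrite mul1r.
apply: convex_comb => // [|p pl]; first exact: convex_hull.
have [p0 [_ pe]] := lC p pl; split => //; apply: subset_hull; split => //.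
exists (pickle (rcons (odflt [::] (unpickle n)) (k, index p (ch (d n) k)))) => //.
by rewrite /d pickleK /= /D foldl_rcons /child /= nth_index.
Qed.

Definition approximable (y : nat -> X) := [set x | forall e, 0 < e ->
  exists n, `‖x - y n‖ < e].

(** [y] enumerates the finite combinations of the [d n] with coefficients in a countable dense set
    of scalars; [approximable y] is then the closed linear span of [d]. *)
Lemma countable_span (d : nat -> X) : exists y : nat -> X,
  [/\ forall n, approximable y (d n),
      forall u v, approximable y u -> approximable y v -> approximable y (u + v) &
      forall k u, approximable y u -> approximable y (k *: u)].
Proof.
have [q qP] := scalars_separable s.
pose Y (t : seq (nat * nat)) := \sum_(p <- t) q p.1 *: d p.2.
pose code n : seq (nat * nat) := odflt [::] (unpickle n).
pose y n := Y (code n).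
have yY t : y (pickle t) = Y t by rewrite /y /code pickleK.
have yD u v : approximable y u -> approximable y v -> approximable y (u + v).
  move=> yu yv e e0; have [n un] := yu _ (divr_gt0 e0 (ltr0Sn _ 1)).
  have [m vm] := yv _ (divr_gt0 e0 (ltr0Sn _ 1)).
  exists (pickle (code n ++ code m)).
  rewrite yY /Y big_cat/= opprD addrACA.
  apply: le_lt_trans (rnormD _ _ _) _; rewrite -/(Y _) -/(y n).
  by rewrite -/(Y _) -/(y m); lra.
have y0 : approximable y 0.
  move=> e e0; exists (pickle ([::] : seq (nat * nat))).
  by rewrite yY /Y big_nil subrr rnorm0.
have yd k n : approximable y (k *: d n).
  move=> e e0; have c0 : 0 < `‖d n‖ + 1 by rewrite ltr_wpDl ?rnorm_ge0.
  have [i ki] := qP k _ (divr_gt0 e0 c0); exists (pickle [:: (i, n)]).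
  rewrite yY /Y big_seq1 -scalerBl rnormZ; rewrite ltr_pdivlMr// in ki.
  apply: le_lt_trans ki; rewrite ler_wpM2l ?modulus_ge0//.
  by rewrite lerDl.
exists y; split => // [n|k u yu].
  by have := yd 1 n; rewrite scale1r.
move=> e e0; have c0 : 0 < modulus s k + 1 by rewrite ltr_wpDl ?modulus_ge0.
have [n un] := yu _ (divr_gt0 (divr_gt0 e0 (ltr0Sn _ 1)) c0).
have : approximable y (k *: y n).
  rewrite /y /Y scaler_sumr; elim/big_ind : _ => // p _.
  by rewrite scalerA; exact: yd.
move=> /(_ _ (divr_gt0 e0 (ltr0Sn _ 1)))[m km]; exists m.
apply: le_lt_trans (rdistD s _ (k *: y n) _) _; rewrite -scalerBr rnormZ.
rewrite ltr_pdivlMr// in un.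
have : modulus s k * `‖u - y n‖ <= `‖u - y n‖ * (modulus s k + 1).
  by rewrite mulrC ler_wpM2l ?rnorm_ge0// lerDl.
by lra.
Qed.

End separable_reduction.

(** * Renormings *)

Section equivalent_norms.
Context {R : realType} {K : numFieldType} (s : scalar_field R K).
Context {X : completeNormedModType K}.

Record equivalent_norm (N : X -> R) : Prop := EquivalentNorm {
  eqnormD : forall x y, N (x + y) <= N x + N y;
  eqnormZ : forall k x, N (k *: x) = modulus s k * N x;
  eqnorm_lower : exists2 a, 0 < a & forall x, a * rnorm s x <= N x;
  eqnorm_upper : exists2 b, 0 < b & forall x, N x <= b * rnorm s x
}.

(** This copy of [X] is indexed by the proof [hN], which the instances declared on it use. *)
Definition renormed (N : X -> R) (hN : equivalent_norm N) : Type := X.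

Section structure.
Variables (N : X -> R) (hN : equivalent_norm N).
Local Notation Z := (renormed hN).

HB.instance Definition _ := GRing.Lmodule.on Z.

Let norm (x : Z) : K := ofR s (N x).

Let ler_normD x y : norm (x + y) <= norm x + norm y.
Proof. by rewrite /norm -rmorphD ler_ofR eqnormD. Qed.

Let normrZ k x : norm (k *: x) = `|k| * norm x.
Proof. by rewrite /norm eqnormZ// rmorphM -modulusE. Qed.

Let normr0_eq0 x : norm x = 0 -> x = 0.
Proof.
rewrite /norm -(rmorph0 (ofR s)) => /ofR_inj Nx; apply: (rnorm0_eq0 (s := s)).
have [a a0 /(_ x)] := eqnorm_lower hN; rewrite Nx => aN.
by apply/eqP; rewrite eq_le rnorm_ge0 andbT -(pmulr_rle0 _ a0).
Qed.

HB.instance Definition _ := @Lmodule_isNormed.Build K Z norm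
  ler_normD normrZ normr0_eq0.

Lemma renormed_normE (x : Z) : rnorm s x = N x.
Proof. by rewrite /rnorm ofRK. Qed.

Let renormed_complete (F : set_system Z) : ProperFilter F -> cauchy F -> cvg F.
Proof.
move=> FF /cauchyP Fc; have [a a0 aN] := eqnorm_lower hN.
have [b b0 Nb] := eqnorm_upper hN.
have : cvg (F : set_system X).
  apply: cauchy_cvg; apply/cauchyP => _ /(gt0_ofR s)[e e0 ->].
  have [|x Fx] := Fc (ofR s (a * e)); first by rewrite ofR_gt0 mulr_gt0.
  exists x; apply: filterS Fx => y.
  rewrite -!ball_normE /ball_/= !(normE s) !ltr_ofR renormed_normE => xy.
  by rewrite -(ltr_pM2l a0); exact: le_lt_trans (aN (x - y)) xy.
move=> /cvg_ex[/= l Fl]; apply/cvg_ex; exists (l : Z).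
apply/cvgrPdist_lt => _ /(gt0_ofR s)[e e0 ->].
have be0 : 0 < ofR s (e / b) by rewrite ofR_gt0 divr_gt0.
move/cvgrPdist_lt: Fl => /(_ _ be0); apply: filterS => x.
rewrite !(normE s) !ltr_ofR renormed_normE ltr_pdivlMr// mulrC => lx.
exact: le_lt_trans (Nb _) lx.
Qed.

HB.instance Definition _ := Uniform_isComplete.Build Z renormed_complete.

Definition renormed_space : completeNormedModType K := Z.

Lemma renormed_rnorm (x : renormed_space) : rnorm s x = N x.
Proof. exact: renormed_normE. Qed.

Lemma renormed_isomorphic : isomorphic renormed_space X.
Proof.
have fl : linear (idfun : renormed_space -> X) by [].
have gl : linear (idfun : X -> renormed_space) by [].
exists (linear_of fl), (linear_of gl); split => //.
  apply/(continuous_linearP s); have [a a0 aN] := eqnorm_lower hN.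
  exists a^-1 => [|x]; first by rewrite invr_ge0 ltW.
  by rewrite ler_pdivlMl// renormed_rnorm aN.
apply/(continuous_linearP s); have [b b0 bN] := eqnorm_upper hN.
by exists b => [|x]; [exact: ltW|rewrite renormed_rnorm bN].
Qed.

End structure.

End equivalent_norms.

Section seminorms.
Context {R : realType} {K : numFieldType} (s : scalar_field R K).
Context {X : normedModType K}.
Local Notation "`‖ x ‖" := (rnorm s x) (at level 0, x at level 99).
Implicit Types p q : X -> R.

Definition seminorm p := (forall x y, p (x + y) <= p x + p y) /\
  forall k x, p (k *: x) = modulus s k * p x.

Lemma seminorm_intro p : (forall x y, p (x + y) <= p x + p y) ->
  (forall k x, p (k *: x) <= modulus s k * p x) -> seminorm p.
Proof.
move=> pD pZ; split=> // k x; apply/eqP; rewrite eq_le pZ/=.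
have [->|k0] := eqVneq k 0.
  rewrite /modulus normr0 re0 mul0r scale0r.
  by have := pD 0 0; rewrite addr0; lra.
have kk : modulus s k * modulus s k^-1 = 1.
  by rewrite -modulusM mulfV// modulus1.
have := pZ k^-1 (k *: x); rewrite scalerA mulVf// scale1r.
by move=> /(ler_wpM2l (modulus_ge0 s k)); rewrite mulrA kk mul1r.
Qed.

Lemma seminorm_rnorm : seminorm (fun x => `‖x‖).
Proof. by split=> *; rewrite ?rnormD ?rnormZ. Qed.

Lemma seminorm0 p : seminorm p -> p 0 = 0.
Proof. by move=> [_ pZ]; rewrite -(scale0r 0) pZ /modulus normr0 re0 mul0r. Qed.

Lemma seminormN p x : seminorm p -> p (- x) = p x.
Proof. by move=> [_ pZ]; rewrite -scaleN1r pZ modulusN modulus1 mul1r. Qed.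

Lemma seminorm_ge0 p x : seminorm p -> 0 <= p x.
Proof.
by move=> sp; have := sp.1 x (- x); rewrite subrr seminorm0// seminormN//; lra.
Qed.

Lemma seminorm_sum (I : Type) (r : seq I) (P : pred I) (a : I -> R)
    (q : I -> X -> R) :
  (forall i, 0 <= a i) -> (forall i, seminorm (q i)) ->
  seminorm (fun x => \sum_(i <- r | P i) a i * q i x).
Proof.
move=> a0 sq; split=> [x y|k x].
  rewrite -big_split/=; apply: ler_sum => i _; rewrite -mulrDr.
  by rewrite ler_wpM2l// (sq i).1.
by rewrite mulr_sumr; apply: eq_bigr => i _; rewrite (sq i).2 mulrCA.
Qed.

Lemma seminormD p q : seminorm p -> seminorm q -> seminorm (fun x => p x + q x).
Proof.
move=> [pD pZ] [qD qZ]; split=> [x y|k x]; last by rewrite pZ qZ mulrDr.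
by rewrite addrACA lerD.
Qed.

Definition sup_seminorm (q : nat -> X -> R) x := sup (range (q ^~ x)).

Section sup_seminorm.
Variables (q : nat -> X -> R) (c : R).
Hypotheses (sq : forall n, seminorm (q n)) (qc : forall n x, q n x <= c * `‖x‖).

Lemma le_sup_seminorm n x : q n x <= sup_seminorm q x.
Proof.
by apply: ub_le_sup; [exists (c * `‖x‖) => _ [m _ <-]|exists n].
Qed.

Lemma sup_seminorm_le (b : R) x : (forall n, q n x <= b) -> sup_seminorm q x <= b.
Proof. by move=> qb; apply: ge_sup => [|_ [n _ <-]//]; exists (q 0%N x), 0%N. Qed.

Lemma seminorm_sup : seminorm (sup_seminorm q).
Proof.
apply: seminorm_intro => [x y|k x]; apply: sup_seminorm_le => n.
  by apply: le_trans ((sq n).1 x y) _; rewrite lerD// le_sup_seminorm.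
by rewrite (sq n).2 ler_wpM2l ?modulus_ge0// le_sup_seminorm.
Qed.

End sup_seminorm.

(** The real functional only gives [re (f x) = |x|]. Since [|f x| <= |x|], the law of cosines for
    [k = f x / |x|], of real part 1 and modulus at most 1, forces [k = 1]. *)
Lemma norming_linear x : exists f : {linear X -> K^o},
  (forall z, modulus s (f z) <= `‖z‖) /\ f x = ofR s `‖x‖.
Proof.
have [h [hl hn hx]] := norming_functional s x.
have [|f [fh fn]] := extend_bounded_functional (c := 1) hl.
  by move=> y; rewrite mul1r.
exists f; split; first by move=> z; rewrite -[leRHS]mul1r.
have := fn x; rewrite mul1r => fx.
have [->|x0] := eqVneq x 0; first by rewrite linear0 rnorm0 rmorph0.
have nx := rnorm_gt0 s x0; pose k := ofR s `‖x‖^-1 * f x.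
suff k1 : modulus s (k - 1) = 0.
  have /subr0_eq := modulus0_eq0 k1; rewrite /k => /(congr1 (fun u => ofR s `‖x‖ * u)).
  by rewrite mulrA -rmorphM mulfV ?gt_eqF// rmorph1 mul1r mulr1.
have := re_dist1 s k; rewrite -!/(modulus s _).
have -> : re s k = 1 by rewrite reM fh hx mulVf// gt_eqF.
have : modulus s k <= 1.
  rewrite modulusM modulus_ofR gtr0_norm ?invr_gt0//.
  by rewrite mulrC ler_pdivrMr// mul1r.
by have := modulus_ge0 s k; have := modulus_ge0 s (k - 1); nra.
Qed.

End seminorms.

(** * Norms dented near a given sequence *)

Section denting_norm.
Context {R : realType} {K : numFieldType} (s : scalar_field R K).
Context {X : normedModType K}.
Local Notation "`‖ x ‖" := (rnorm s x) (at level 0, x at level 99).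

(** If [f y = |y|] is nonzero, this is [|x - P x|] for the projection [P] onto the line of [y] along
    the kernel of [f]. For [y = 0] it is [|x|]. *)
Definition line_dist (f : X -> K) (y x : X) : R :=
  `‖x - (f x * ofR s `‖y‖^-1) *: y‖.

Lemma seminorm_line_dist (f : {linear X -> K^o}) y : seminorm s (line_dist f y).
Proof.
split=> [x z|k x]; rewrite /line_dist.
  apply: le_trans (rnormD _ _ _); rewrite linearD mulrDl scalerDl opprD.
  by rewrite addrACA.
rewrite -rnormZ scalerBr scalerA mulrA; congr (rnorm s (_ - (_ * _) *: _)).
exact: linearZ.
Qed.

Lemma line_dist_le (f : {linear X -> K^o}) y x :
  (forall z, modulus s (f z) <= `‖z‖) -> line_dist f y x <= 2 * `‖x‖.
Proof.
move=> fn; rewrite /line_dist; apply: le_trans (rnormB _ _ _) _.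
rewrite rnormZ modulusM modulus_ofR -mulrA.
have y1 : `| `‖y‖^-1 | * `‖y‖ <= 1.
  have [->|y0] := eqVneq y 0; first by rewrite rnorm0 mulr0.
  by rewrite gtr0_norm ?invr_gt0 ?rnorm_gt0// mulVf// gt_eqF ?rnorm_gt0.
have : modulus s (f x) * (`| `‖y‖^-1 | * `‖y‖) <= modulus s (f x) * 1.
  by rewrite ler_wpM2l ?modulus_ge0.
by have := fn x; lra.
Qed.

Variables (N Q : X -> R) (b : R) (f : {linear X -> K^o}) (y : X).
Hypotheses (sN : seminorm s N) (b0 : 0 < b).
Hypotheses (N_ge : forall z, `‖z‖ <= N z) (N_le : forall z, N z <= 3 * `‖z‖).
Hypothesis NQ : forall z, N z = Q z + b * line_dist f y z.
Hypotheses (fn : forall z, modulus s (f z) <= `‖z‖) (fy : f y = ofR s `‖y‖).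

(* [Q + t re f], which is convex, dents the ball of [N] at [z0]: points far from
   the line spanned by [y] have a smaller [Q], and points close to this line but
   far from [z0] have a smaller [re f]. *)
Lemma denting_near (e k r : R) (z0 : X) : 0 < e -> e <= 1 ->
    e * e = 8 * (8 * (8 * k)) -> k * k = 6 * (6 * r) ->
    N z0 = 1 -> `‖z0 - y‖ <= r ->
  exists t d, [/\ 0 <= t, 0 < d & forall z, N z <= 1 -> e <= `‖z - z0‖ ->
    Q z + t * re s (f z) <= Q z0 + t * re s (f z0) - d].
Proof.
move=> e0 e1 kE rE Nz0 z0y.
have ee : e * e <= e by nra.
have e_gt0 : 0 < e * e by rewrite mulr_gt0.
have k0 : 0 < k by lra.
have k1 : k <= 1 / 64 by lra.
have kk_gt0 : 0 < k * k by rewrite mulr_gt0.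
have r0 : 0 < r by lra.
have rk : r <= k / 64 by nra.
have z01 : `‖z0‖ <= 1 by rewrite -Nz0.
have z03 : 1 / 3 <= `‖z0‖ by have := N_le z0; rewrite Nz0; lra.
have y_le : `‖y‖ <= 1 + r by have := rnormB s z0 (z0 - y); rewrite subKr; lra.
have y_ge : 1 / 4 <= `‖y‖ by have := rnormD s (z0 - y) y; rewrite subrK; lra.
have y0 : 0 < `‖y‖ by lra.
have lz0 : line_dist f y z0 <= 2 * r.
  have := (seminorm_line_dist f y).1 (z0 - y) y; rewrite subrK.
  have := line_dist_le y (z0 - y) fn; have -> : line_dist f y y = 0.
    by rewrite /line_dist fy -rmorphM mulfV ?gt_eqF// rmorph1 scale1r subrr rnorm0.
  by lra.
have fz0 : `‖y‖ - r <= re s (f z0).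
  have fyz : re s (f (y - z0)) = `‖y‖ - re s (f z0) by rewrite linearB reB fy ofRK.
  have := re_le_modulus s (f (y - z0)); rewrite fyz.
  by have := fn (y - z0); rewrite (rdistC s y z0); lra.
have Ny : 1 - 3 * r <= N y.
  by have := sN.1 (z0 - y) y; rewrite subrK Nz0; have := N_le (z0 - y); lra.
have fz0' : - 1 <= re s (f z0).
  by have := norm_re_le s (f z0); rewrite ler_norml => /andP[+ _]; have := fn z0; lra.
have k12 : 0 <= k / 12 by rewrite divr_ge0// ltW.
have bk12 : 0 <= b * (k / 12) by rewrite mulr_ge0// ltW.
(* As [line_dist f y z0 <= 2 * r], [Q z] exceeds [Q z0] by at most [2 * b * r]. Near the line
   [re (f z)] drops by [k], a gain of [b * k * k / 12 = 3 * b * r]. Far from it [Q] drops by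
   [b * k / 4], while the functional regains at most [b * k / 6]. *)
exists (b * (k / 12)), (b * r); split => //; first by rewrite mulr_gt0.
move=> z Nz ez; pose m := f z * ofR s `‖y‖^-1; pose q := line_dist f y z.
have qE : q = `‖z - m *: y‖ by [].
have q0 : 0 <= q by rewrite qE rnorm_ge0.
have Qz : Q z = N z - b * q by rewrite NQ addrK.
have Qz0 : Q z0 = 1 - b * line_dist f y z0 by rewrite -Nz0 NQ addrK.
have fz1 : re s (f z) <= 1.
  by have := re_le_modulus s (f z); have := fn z; have := N_ge z; lra.
suff : q <= 1 / 4 * k -> re s (f z) + k <= re s (f z0).
  move=> small; have [qk|qk] := leP q (1 / 4 * k).
    have h1 := small qk; rewrite Qz Qz0.
    have h2 : 0 <= b * q by rewrite mulr_ge0// ltW.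
    have h3 : b * line_dist f y z0 <= b * (2 * r) by rewrite ler_wpM2l// ltW.
    have h4 : b * (k / 12) * (re s (f z) + k) <= b * (k / 12) * re s (f z0).
      by rewrite ler_wpM2l.
    have h5 : b * (k / 12) * k = 3 * (b * r).
      by rewrite -mulrA -[k / 12 * k]mulrAC rE; field.
    by lra.
  rewrite Qz Qz0.
  have h3 : b * line_dist f y z0 <= b * (2 * r) by rewrite ler_wpM2l// ltW.
  have h4 : b * (1 / 4 * k) <= b * q by rewrite ler_wpM2l// ltW.
  have h5 : b * (k / 12) * (re s (f z) - re s (f z0)) <= b * (k / 12) * 2.
    by rewrite ler_wpM2l//; lra.
  have h6 : b * r <= b * (k / 64) by rewrite ler_wpM2l// ltW.
  have h7 : 0 < b * k by rewrite mulr_gt0.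
  by lra.
(* Here [z] is close to [m *: y]. Then [N z <= 1] gives [|m| <= 1 + k], and the distance from [z] to
   [z0] gives [|m - 1| >= e / 2]; by the law of cosines, [re m] is smaller than 1 by a multiple of
   [e * e], that is, of [k]. *)
move=> qk.
have my : modulus s m * N y <= 1 + 3 * (1 / 4 * k).
  rewrite -sN.2; have := sN.1 z (m *: y - z); rewrite addrC subrK => mD.
  by have := N_le (m *: y - z); rewrite rdistC -qE; lra.
have m0 := modulus_ge0 s m.
have m_le : modulus s m <= 1 + k.
  have : modulus s m * (1 - 3 * r) <= modulus s m * N y by rewrite ler_wpM2l.
  by nra.
have m1_ge : e / 2 <= modulus s (m - 1).
  have : e - 1 / 4 * k - r <= modulus s (m - 1) * `‖y‖.
    rewrite -rnormZ scalerBl scale1r.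
    have := rdistD s z (m *: y) z0; rewrite -qE.
    by have := rdistD s (m *: y) y z0; rewrite (rdistC s y z0); lra.
  have : modulus s (m - 1) * `‖y‖ <= modulus s (m - 1) * (1 + r).
    by rewrite ler_wpM2l ?modulus_ge0.
  have := modulus_ge0 s (m - 1); nra.
have mre : re s m <= 1 - 16 * k.
  have := re_dist1 s m; rewrite -!/(modulus s _) => md.
  have : modulus s m ^+ 2 <= 1 + 3 * k by rewrite expr2; nra.
  have : 2 * (8 * (8 * k)) <= modulus s (m - 1) ^+ 2 by rewrite expr2; nra.
  by lra.
have fzE : re s (f z) = `‖y‖ * re s m.
  have -> : re s m = `‖y‖^-1 * re s (f z) by rewrite /m mulrC reM.
  by rewrite mulrA mulfV ?gt_eqF// mul1r.
have : `‖y‖ * re s m <= `‖y‖ * (1 - 16 * k) by rewrite ler_wpM2l// ltW.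
have : 1 / 4 * (16 * k) <= `‖y‖ * (16 * k) by rewrite ler_wpM2r//; lra.
by rewrite fzE; lra.
Qed.

End denting_norm.

Section denting_renorming.
Context {R : realType} {K : numFieldType} (s : scalar_field R K).
Context {X : normedModType K}.
Local Notation "`‖ x ‖" := (rnorm s x) (at level 0, x at level 99).

Lemma sum_half_expn m : \sum_(0 <= i < m) 2^-1 ^+ i.+1 = 1 - 2^-1 ^+ m :> R.
Proof.
elim: m => [|m ih]; first by rewrite big_nil expr0 subrr.
by rewrite big_nat_recr//= ih exprS; field.
Qed.

Lemma sublevel_closed_convex (Q : X -> R) (f : {linear X -> K^o}) (c t d : R) :
    seminorm s Q -> (forall x, Q x <= c * `‖x‖) ->
    (forall z, modulus s (f z) <= `‖z‖) -> 0 <= t ->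
  closed [set z | Q z + t * re s (f z) <= d] /\
  convex_set ([set z | Q z + t * re s (f z) <= d] : set (convex_lmodType X)).
Proof.
move=> [QD QZ] Qc fn t0; split.
  apply/(closedP s) => x xP; apply/ler_addgt0Pr => e e0.
  have c0 : 0 < `|c| + t + 1 by rewrite ltr_wpDl// addr_ge0.
  have [z /= zP xz] := xP _ (divr_gt0 e0 c0); rewrite ltr_pdivlMr// in xz.
  have := QD (x - z) z; rewrite subrK; have := Qc (x - z).
  have := re_le_modulus s (f (x - z)); have := fn (x - z).
  have -> : re s (f (x - z)) = re s (f x) - re s (f z) by rewrite linearB reB.
  move=> h1 h2; have : t * (re s (f x) - re s (f z)) <= t * `‖x - z‖.
    by rewrite ler_wpM2l// (le_trans h2).
  have : c * `‖x - z‖ <= `|c| * `‖x - z‖ by rewrite ler_wpM2r ?rnorm_ge0// ler_norm.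
  by have := rnorm_ge0 s (x - z); lra.
apply/(convexP s) => x y u /= xP yP /andP[u0 u1].
have := QD (ofR s u *: x) (ofR s (1 - u) *: y); rewrite !QZ !modulus_ofR.
rewrite !ger0_norm ?subr_ge0// => QQ.
have -> : re s (f (ofR s u *: x + ofR s (1 - u) *: y)) =
    u * re s (f x) + (1 - u) * re s (f y).
  by rewrite linearD reD !linearZ/= !reM.
have : u * (Q x + t * re s (f x)) <= u * d by rewrite ler_wpM2l.
have : (1 - u) * (Q y + t * re s (f y)) <= (1 - u) * d.
  by rewrite ler_wpM2l// subr_ge0.
by lra.
Qed.

(** [N] is the norm plus the sum of [2^-(n+1) * line_dist (f n) (y n)], so the factor 3 is [1 + 2].
    Without its term of index [n] the sum is still a seminorm [Q], and a sublevel set of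
    [Q + t re (f n)] separates [z0] from the far points. *)
Lemma denting_renorming (y : nat -> X) : exists N : X -> R,
  [/\ seminorm s N, forall z, `‖z‖ <= N z, forall z, N z <= 3 * `‖z‖ &
   forall e k r n z0, 0 < e -> e <= 1 ->
    e * e = 8 * (8 * (8 * k)) -> k * k = 6 * (6 * r) ->
    N z0 = 1 -> `‖z0 - y n‖ <= r ->
    ~ closed_convex_hull [set z | N z <= 1 /\ e <= `‖z - z0‖] z0].
Proof.
have [f fP] := choice (fun n => norming_linear s (y n)).
have fn n := (fP n).1; have fy n := (fP n).2.
pose h : R := 2^-1; pose q n := line_dist s (f n) (y n).
have sq n : seminorm s (q n) by exact: seminorm_line_dist.
have q2 n z : q n z <= 2 * `‖z‖ by exact: line_dist_le.
have q0 n z : 0 <= q n z by exact: seminorm_ge0.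
have h_gt0 n : 0 < h ^+ n by rewrite exprn_gt0// invr_gt0.
have h0 n : 0 <= h ^+ n by exact: ltW.
pose p (P : pred nat) m z := `‖z‖ + \sum_(0 <= i < m | P i) h ^+ i.+1 * q i z.
have sp P m : seminorm s (p P m).
  by apply: seminormD; [exact: seminorm_rnorm|exact: seminorm_sum].
have pP P m z : p P m z <= p predT m z.
  rewrite /p lerD2l [leRHS](bigID P)/= lerDl.
  by apply: sumr_ge0 => i _; rewrite mulr_ge0.
have p3 P m z : p P m z <= 3 * `‖z‖.
  apply: le_trans (pP P m z) _; rewrite /p.
  have : \sum_(0 <= i < m) h ^+ i.+1 * q i z <=
      \sum_(0 <= i < m) h ^+ i.+1 * (2 * `‖z‖).
    by apply: ler_sum => i _; rewrite ler_wpM2l.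
  rewrite -mulr_suml sum_half_expn; have := rnorm_ge0 s z.
  have : 0 <= h ^+ m * `‖z‖ by rewrite mulr_ge0// rnorm_ge0.
  by rewrite /h; lra.
have p_ge P m z : `‖z‖ <= p P m z.
  by rewrite /p lerDl; apply: sumr_ge0 => i _; rewrite mulr_ge0.
pose N := sup_seminorm (p predT).
have Nz z : `‖z‖ <= N z.
  by apply: le_trans (le_sup_seminorm (p3 predT) 0 z); exact: p_ge.
have N3 z : N z <= 3 * `‖z‖ by apply: sup_seminorm_le => m; exact: p3.
have sN : seminorm s N by exact: seminorm_sup (p3 predT).
exists N; split => // e k r n z0 e0 e1 kE rE Nz0 z0y.
(* Partial sums start at length [n.+1], so that each of the full ones contains the term of index
   [n]. *)
pose Q := sup_seminorm (fun m => p (predC1 n) (n.+1 + m)).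
have Q3 m z : p (predC1 n) (n.+1 + m) z <= 3 * `‖z‖ by exact: p3.
have sQ : seminorm s Q by exact: seminorm_sup Q3.
have pE m z : p predT (n.+1 + m) z = p (predC1 n) (n.+1 + m) z + h ^+ n.+1 * q n z.
  have nm : n \in index_iota 0 (n.+1 + m).
    by rewrite mem_index_iota; apply/andP; split => //; exact: ltn_addr.
  rewrite /p (bigD1_seq n nm (iota_uniq _ _))/= -addrA; congr (_ + _).
  by rewrite addrC.
have NQ z : N z = Q z + h ^+ n.+1 * q n z.
  apply/eqP; rewrite eq_le; apply/andP; split.
    apply: sup_seminorm_le => m; apply: (@le_trans _ _ (p predT (n.+1 + m) z)).
      rewrite /p lerD2l [leRHS](@big_cat_nat _ _ _ m)//= ?leq_addl// lerDl.
      by apply: sumr_ge0 => i _; rewrite mulr_ge0.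
    by rewrite pE lerD2r; exact: (le_sup_seminorm Q3).
  rewrite -lerBrDr; apply: sup_seminorm_le => m; rewrite lerBrDr -pE.
  exact: (le_sup_seminorm (p3 predT)).
have [t [d [t0 d0 tP]]] :=
  denting_near sN (h_gt0 n.+1) Nz N3 NQ (fn n) (fy n) e0 e1 kE rE Nz0 z0y.
have [|cl cv] := @sublevel_closed_convex Q (f n) 3 t
    (Q z0 + t * re s (f n z0) - d) sQ _ (fn n) t0.
  by move=> z; apply: sup_seminorm_le => m; exact: Q3.
have sub : [set z | N z <= 1 /\ e <= `‖z - z0‖] `<=`
    [set z | Q z + t * re s (f n z) <= Q z0 + t * re s (f n z0) - d].
  by move=> z [Nz1 ez]; exact: tP.
by move=> /(hull_min cl cv sub); apply/negP; rewrite -ltNge gtrBl.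
Qed.

End denting_renorming.

(** * Inverses of operators close to the identity *)

Section near_identity.
Context {R : realType} {K : numFieldType} (s : scalar_field R K).
Context {X : completeNormedModType K}.
Local Notation "`‖ x ‖" := (rnorm s x) (at level 0, x at level 99).

(** The Neumann series, as the iteration [z + (x - S z)]: each step halves the residual
    [x - S z]. *)
Lemma near_identity_inverse (S : {linear X -> X}) :
    (forall z, `‖S z - z‖ <= 2^-1 * `‖z‖) ->
  exists V : {linear X -> X}, [/\ cancel V S, cancel S V &
    forall x, `‖V x‖ <= 2 * `‖x‖].
Proof.
move=> Sid; pose h : R := 2^-1.
have S_ge z : `‖z‖ <= 2 * `‖S z‖.
  by have := Sid z; have := rnormB s (S z) (S z - z); rewrite subKr; lra.
have S_le z : `‖S z‖ <= 2 * `‖z‖.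
  have := Sid z; have := rnormD s (S z - z) z; rewrite subrK.
  by have := rnorm_ge0 s z; lra.
have surj x : exists z, S z = x.
  pose u n := iter n (fun z => z + (x - S z)) 0.
  have res n : `‖x - S (u n)‖ <= `‖x‖ * h ^+ n.
    elim: n => [|n ih]; first by rewrite /= linear0 subr0 expr0 mulr1.
    rewrite /= -/(u n) linearD opprD addrA rdistC; apply: le_trans (Sid _) _.
    by rewrite exprS /h; lra.
  have step n m : `‖u (n + m)%N - u n‖ <= 2 * `‖x‖ * (h ^+ n - h ^+ (n + m)).
    elim: m => [|m ih]; first by rewrite addn0 !subrr rnorm0 mulr0.
    apply: le_trans (rdistD s _ (u (n + m)%N) _) _; rewrite addnS.
    have -> : u (n + m).+1 - u (n + m)%N = x - S (u (n + m)%N).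
      by rewrite /= -/(u _) addrAC subrr add0r.
    by have := res (n + m)%N; rewrite exprS /h; lra.
  have h0 n : 0 <= h ^+ n by rewrite exprn_ge0// invr_ge0.
  have [e e0|z zP] := @completeP _ _ s X u.
    have [N NP] := half_expn_lt (4 * `‖x‖) e0; exists N => m n Nm Nn.
    apply: le_lt_trans (rdistD s _ (u N) _) _; rewrite (rdistC s (u N)).
    have := step N (m - N)%N; have := step N (n - N)%N; rewrite !subnKC//.
    have := NP N (leqnn N); rewrite -/h.
    have : 0 <= `‖x‖ * h ^+ m by rewrite mulr_ge0 ?rnorm_ge0.
    have : 0 <= `‖x‖ * h ^+ n by rewrite mulr_ge0 ?rnorm_ge0.
    by lra.
  exists z; apply/subr0_eq/(rnorm0_eq0 (s := s))/eqP.
  rewrite eq_le rnorm_ge0 andbT; apply/ler_addgt0Pr => e e0; rewrite add0r.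
  have [N1 N1P] := zP _ (divr_gt0 e0 (ltr0Sn _ 3)).
  have [N2 N2P] := half_expn_lt `‖x‖ (divr_gt0 e0 (ltr0Sn _ 1)).
  pose n := maxn N1 N2.
  have := N1P n (leq_maxl _ _); have := N2P n (leq_maxr _ _); have := res n.
  have := S_le (z - u n); rewrite linearB; rewrite (rdistC s x (S (u n))).
  by have := rdistD s (S z) (S (u n)) x; rewrite /h; lra.
have [V SV] := choice surj.
have S_inj : injective S.
  move=> a b Sab; apply/subr0_eq/(rnorm0_eq0 (s := s))/eqP; rewrite eq_le rnorm_ge0 andbT.
  by have := S_ge (a - b); rewrite linearB Sab subrr rnorm0 mulr0.
have Vl : linear V by move=> a x y; apply: S_inj; rewrite linearP !SV.
exists (linear_of Vl); split => [x|z|x]; rewrite !linear_ofE//.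
  by apply: S_inj; rewrite SV.
by have := S_ge (V x); rewrite SV.
Qed.

End near_identity.

(** * Minkowski gauges *)

Section gauge.
Context {R : realType} {K : numFieldType} (s : scalar_field R K).
Context {X : normedModType K}.
Local Notation "`‖ x ‖" := (rnorm s x) (at level 0, x at level 99).

Definition gauge (B : set X) x : R := inf [set t | 0 < t /\ B (ofR s t^-1 *: x)].

Variables (B : set X) (r M : R).
Hypotheses (cB : closed B) (vB : convex_set (B : set (convex_lmodType X))).
Hypothesis balB : forall k x, modulus s k = 1 -> B x -> B (k *: x).
Hypotheses (r0 : 0 < r) (rB : forall x, `‖x‖ <= r -> B x).
Hypotheses (M0 : 0 < M) (BM : forall x, B x -> `‖x‖ <= M).

Let cvx := (convexP s B).1 vB.

Let B0 : B 0. Proof. by apply: rB; rewrite rnorm0 ltW. Qed.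

Lemma gauge_le t x : 0 < t -> B (ofR s t^-1 *: x) -> gauge B x <= t.
Proof. by move=> t0 Bt; apply: ge_inf => //; exists 0 => u [/ltW]. Qed.

Lemma gauge_ge b x : (forall t, 0 < t -> B (ofR s t^-1 *: x) -> b <= t) ->
  b <= gauge B x.
Proof.
move=> bt; apply: lb_le_inf => [|t [t0 Bt]]; last exact: bt.
have c0 : 0 < (`‖x‖ + 1) / r by rewrite divr_gt0// ltr_wpDl ?rnorm_ge0.
exists ((`‖x‖ + 1) / r); split => //; apply: rB.
rewrite rnormZr gtr0_norm ?invr_gt0// invf_div mulrAC ler_pdivrMr ?ltr_wpDl ?rnorm_ge0//.
by apply: ler_wpM2l; [exact: ltW|rewrite lerDl].
Qed.

Lemma gauge_ge0 x : 0 <= gauge B x.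
Proof. by apply: gauge_ge => t /ltW. Qed.

Lemma gauge_lt t x : gauge B x < t -> B (ofR s t^-1 *: x).
Proof.
move=> xt; have t0 : 0 < t by exact: le_lt_trans (gauge_ge0 x) xt.
apply: contrapT => nB; move: xt; apply/negP; rewrite -leNgt.
apply: gauge_ge => u u0 Bu; rewrite leNgt; apply/negP => ut; apply: nB.
have := cvx (t := u / t) Bu B0; rewrite scaler0 addr0 scalerA -rmorphM.
have -> : u / t * u^-1 = t^-1 by field; rewrite !gt_eqF.
by apply; rewrite ler_pdivrMr// mul1r (ltW ut) andbT divr_ge0// ltW.
Qed.

Lemma seminorm_gauge : seminorm s (gauge B).
Proof.
apply: seminorm_intro => [x y|k x].
  apply/ler_addgt0Pr => e e0; have e2 := divr_gt0 e0 (ltr0Sn R 1).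
  pose t := gauge B x + e / 2; pose u := gauge B y + e / 2.
  have t0 : 0 < t by rewrite ltr_wpDl// gauge_ge0.
  have u0 : 0 < u by rewrite ltr_wpDl// gauge_ge0.
  have tu : 0 < t + u by rewrite addr_gt0.
  have -> : gauge B x + gauge B y + e = t + u by rewrite /t /u; lra.
  apply: gauge_le => //.
  have Bt : B (ofR s t^-1 *: x) by apply: gauge_lt; rewrite /t ltrDl.
  have Bu : B (ofR s u^-1 *: y) by apply: gauge_lt; rewrite /u ltrDl.
  have := cvx (t := t / (t + u)) Bt Bu; rewrite !scalerA -!rmorphM.
  have -> : t / (t + u) * t^-1 = (t + u)^-1 by field; rewrite !gt_eqF.
  have -> : (1 - t / (t + u)) * u^-1 = (t + u)^-1 by field; rewrite !gt_eqF.
  rewrite scalerDr; apply.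
  by rewrite ler_pdivrMr// mul1r lerDl (ltW u0) andbT divr_ge0// ltW.
have [->|k0] := eqVneq k 0.
  rewrite scale0r /modulus normr0 re0 mul0r; apply/ler_addgt0Pr => e e0.
  by rewrite add0r; apply: gauge_le => //; rewrite scaler0.
have m0 : 0 < modulus s k.
  by rewrite lt_def modulus_ge0 andbT; apply: contra_neq k0 => /modulus0_eq0.
rewrite mulrC -ler_pdivrMr//; apply: gauge_ge => t t0 Bt; rewrite ler_pdivrMr//.
apply: gauge_le; first exact: mulr_gt0.
have -> : ofR s (t * modulus s k)^-1 *: (k *: x) =
    (ofR s (modulus s k)^-1 * k) *: (ofR s t^-1 *: x).
  by rewrite !scalerA invfM rmorphM; congr (_ *: _); ring.
by apply: balB => //; rewrite modulusM modulus_ofR gtr0_norm ?invr_gt0// mulVf// gt_eqF.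
Qed.

Lemma gauge_le1 x : B x -> gauge B x <= 1.
Proof. by move=> Bx; apply: gauge_le => //; rewrite invr1 rmorph1 scale1r. Qed.

(** The points [x / t] with [t > 1] lie in [B] and tend to [x]; closedness does the rest. *)
Lemma gauge_le1_mem x : gauge B x <= 1 -> B x.
Proof.
move=> x1; apply/((closedP s B).1 cB) => e e0.
pose t := 1 + e / (`‖x‖ + 1).
have c0 : 0 < `‖x‖ + 1 by rewrite ltr_wpDl ?rnorm_ge0.
have t1 : 0 < e / (`‖x‖ + 1) by rewrite divr_gt0.
exists (ofR s t^-1 *: x).
  by apply: gauge_lt; apply: le_lt_trans x1 _; rewrite /t ltrDl.
have t0 : 0 < t by rewrite addr_gt0.
rewrite -{1}(scale1r x) -(rmorph1 (ofR s)) -scalerBl -rmorphB rnormZr.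
have -> : 1 - t^-1 = (e / (`‖x‖ + 1)) / t.
  apply: (mulIf (lt0r_neq0 t0)).
  by rewrite divfK ?gt_eqF// mulrBl mulVf ?gt_eqF// /t; ring.
rewrite gtr0_norm ?divr_gt0// mulrAC ltr_pdivrMr//.
apply: (@lt_le_trans _ _ e); last by rewrite ler_pMr// /t lerDl ltW.
by rewrite mulrAC ltr_pdivrMr// ltr_pM2l// ltrDl.
Qed.

Lemma gauge_upper x : gauge B x <= r^-1 * `‖x‖.
Proof.
have [->|x0] := eqVneq x 0.
  by rewrite (seminorm0 seminorm_gauge) rnorm0 mulr0.
have nx := rnorm_gt0 s x0; have c0 : 0 < r^-1 * `‖x‖ by rewrite mulr_gt0// invr_gt0.
apply: gauge_le => //; apply: rB; rewrite rnormZr gtr0_norm ?invr_gt0//.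
by rewrite invfM invrK -mulrA mulVf ?mulr1// gt_eqF.
Qed.

Lemma gauge_lower x : M^-1 * `‖x‖ <= gauge B x.
Proof.
apply: gauge_ge => t t0 /BM; rewrite rnormZr gtr0_norm ?invr_gt0//.
by rewrite mulrC ler_pdivrMr// => xM; rewrite ler_pdivrMl.
Qed.

End gauge.

(** * Huff's renormings *)

Section huff_renorming.
Context {R : realType} {K : numFieldType} (s : scalar_field R K).
Context {X : completeNormedModType K}.
Local Notation "`‖ x ‖" := (rnorm s x) (at level 0, x at level 99).

Lemma hull_nonempty (A : set X) x : closed_convex_hull A x -> A !=set0.
Proof.
move=> Ax; apply/set0P; apply: contra_notN (_ : ~ A = set0) => [/eqP//|A0].
suff : (set0 : set X) x by [].
apply: (hull_min _ _ _ Ax); first exact: closed0.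
- by move=> y z t /set_mem.
- by rewrite A0.
Qed.

Section thickened_orbit.
Variables (d y : nat -> X) (e r M : R).
Hypotheses (e0 : 0 < e) (nd : nondentable s e (range d)) (dM : forall n, `‖d n‖ <= M).
Hypotheses (r0 : 0 < r) (r1 : r <= 1).
Hypotheses (yd : forall n, approximable s y (d n)).
Hypotheses (yD : forall u v, approximable s y u -> approximable s y v ->
  approximable s y (u + v)).
Hypotheses (yZ : forall k u, approximable s y u -> approximable s y (k *: u)).

(** Unimodular multiples make the gauge of the hull homogeneous over [K], and the balls of radius
    [r] make it equivalent to the norm. *)
Let E := [set x : X | exists k n b,
  [/\ modulus s k = 1, `‖b‖ <= r & x = k *: d n + b]].
Let B := closed_convex_hull E.

Let affine_isometry k (b : X) : modulus s k = 1 ->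
  (forall (u v : X) t, k *: (ofR s t *: u + ofR s (1 - t) *: v) + b =
     ofR s t *: (k *: u + b) + ofR s (1 - t) *: (k *: v + b)) /\
  (forall u v : X, `‖(k *: u + b) - (k *: v + b)‖ <= 1 * `‖u - v‖).
Proof.
move=> k1; split=> u v => [t|].
  rewrite !scalerDr !scalerA ![k * _]mulrC addrACA -[in RHS]scalerDl -rmorphD.
  by rewrite [t + _]addrC subrK rmorph1 scale1r.
by rewrite opprD addrACA subrr addr0 -scalerBr rnormZ k1.
Qed.

(** The affine isometry [z -> k *: z + b] maps the range of [d] into [E], carrying nondentability
    from [d n] to [k *: d n + b]. Passing to the closed convex hull costs the factor 3. *)
Lemma nondentable_thickened_orbit : nondentable s (e / 3) B.
Proof.
have e3 : e / 3 + e / 3 < e by move: e0; lra.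
suff nE : nondentable s e E.
  by apply: (nondentable_hull nE _ _ e3) => //; exact: subset_hull.
move=> _ [k [n [b [k1 br ->]]]]; have [ga gl] := affine_isometry b k1.
have dn : range d (d n) by exists n.
apply: (hull_image ga gl _ (nd dn)) => _ [[m _ <-] em]; apply: subset_hull; split.
  by exists k, m, b.
by rewrite opprD addrACA subrr addr0 -scalerBr rnormZ k1 mul1r.
Qed.

Lemma thickened_orbit_balanced k x : modulus s k = 1 -> B x -> B (k *: x).
Proof.
move=> k1; have [ga gl] := affine_isometry 0 k1; rewrite -[k *: x]addr0.
apply: (hull_image ga gl) => _ [l [n [b [l1 br ->]]]]; apply: subset_hull.
exists (k * l), n, (k *: b); split; first by rewrite modulusM k1 l1 mulr1.
  by rewrite rnormZ k1 mul1r.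
by rewrite addr0 scalerDr scalerA.
Qed.

Lemma thickened_orbit_bounded x : B x -> `‖x‖ <= M + 1.
Proof.
apply: hull_bounded => _ [k [n [b [k1 br ->]]]].
apply: le_trans (rnormD _ _ _) _; rewrite rnormZ k1 mul1r.
by move: (dM n) r1; lra.
Qed.

(** [x] is the midpoint of [d 0 + x] and [- d 0 + x], two points of [E]. *)
Lemma thickened_orbit_ball x : `‖x‖ <= r -> B x.
Proof.
move=> xr; have EB : E `<=` B by exact: subset_hull.
have B1 : B (1 *: d 0%N + x).
  by apply: EB; exists 1, 0%N, x; rewrite modulus1.
have B2 : B (- 1 *: d 0%N + x).
  by apply: EB; exists (-1), 0%N, x; rewrite modulusN modulus1.
have /(convexP s) vB := @convex_hull _ X E.
have h01 : 0 <= (2^-1 : R) <= 1 by apply/andP; split; lra.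
have := vB _ _ 2^-1 B1 B2 h01.
have -> : 1 - 2^-1 = 2^-1 :> R by field.
rewrite -scalerDr scaleNr addrACA subrr add0r scalerDr -scalerDl -rmorphD.
have -> : 2^-1 + 2^-1 = 1 :> R by field.
by rewrite rmorph1 scale1r.
Qed.

Lemma orbit_mem n : B (d n).
Proof.
apply: subset_hull; exists 1, n, 0.
by rewrite modulus1 rnorm0 scale1r addr0 ltW.
Qed.

(** The points at distance at most [r] from a linear subspace form a closed convex set, and [E] is
    contained in it. *)
Lemma thickened_orbit_near x t : B x -> 0 < t ->
  exists2 u, approximable s y u & `‖x - u‖ < r + t.
Proof.
move=> Bx; pose C := [set x | forall t, 0 < t ->
  exists2 u, approximable s y u & `‖x - u‖ < r + t].
suff : C x by exact.
apply: (hull_min _ _ _ Bx).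
- apply/(closedP s) => z zP t' t'0.
  have [w wC zw] := zP _ (divr_gt0 t'0 (ltr0Sn _ 1)).
  have [u yu wu] := wC _ (divr_gt0 t'0 (ltr0Sn _ 1)); exists u => //.
  by have := rdistD s z w u; lra.
- apply/(convexP s) => z w a zC wC /andP[a0 a1] t' t'0.
  have t2 := divr_gt0 t'0 (ltr0Sn R 1).
  have [u yu zu] := zC _ t2; have [v yv wv] := wC _ t2.
  exists (ofR s a *: u + ofR s (1 - a) *: v); first by apply: yD; exact: yZ.
  rewrite opprD addrACA -!scalerBr; apply: le_lt_trans (rnormD _ _ _) _.
  rewrite !rnormZr !ger0_norm ?subr_ge0//.
  have : a * `‖z - u‖ <= a * (r + t' / 2) by rewrite ler_wpM2l// ltW.
  have : (1 - a) * `‖w - v‖ <= (1 - a) * (r + t' / 2).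
    by rewrite ler_wpM2l ?subr_ge0// ltW.
  by lra.
- move=> _ [k [n [b [k1 br ->]]]] t' t'0; exists (k *: d n); first exact: yZ.
  by rewrite addrAC subrr add0r; lra.
Qed.

Hypothesis dn0 : exists n, e / 2 <= `‖d n‖.

Variables (N : X -> R) (w k rho theta : R).
Hypotheses (sN : seminorm s N) (N_ge : forall z, `‖z‖ <= N z).
Hypothesis N_le : forall z, N z <= 3 * `‖z‖.
Hypothesis N_denting : forall n z0, N z0 = 1 -> `‖z0 - y n‖ <= rho ->
    ~ closed_convex_hull [set z | N z <= 1 /\ w <= `‖z - z0‖] z0.
Hypotheses (rho0 : 0 < rho) (M0 : 0 <= M) (w0 : 0 < w) (theta0 : 0 <= theta).
Hypotheses (w_le : w * (36 * (M + 1)) <= e).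
Hypotheses (r_le : 12 * r <= rho * e) (theta_rho : 4 * (M + 1) * theta <= rho).
Hypotheses (theta_M : 6 * (M + 1) * theta <= 1) (theta_e : theta * e <= 1).

Let G := gauge s B.
Let M1 : 0 < M + 1. Proof. by rewrite ltr_wpDl. Qed.

Let cB : closed B. Proof. exact: closed_hull. Qed.
Let vB : convex_set (B : set (convex_lmodType X)). Proof. exact: convex_hull. Qed.

Lemma seminorm_orbit_gauge : seminorm s G.
Proof. exact: seminorm_gauge vB thickened_orbit_balanced r0 thickened_orbit_ball. Qed.

(* [N_denting] is contradicted at [z0]: the nondentability of [B] at the multiple
   [x1] of [S z0] is transported by the inverse [V] of [S]. *)
Lemma no_minimum_near_identity (S : {linear X -> X}) z0 :
  (forall z, G (S z - z) <= theta * N z) -> N z0 = 1 ->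
  (forall z, N z = 1 -> G (S z0) <= G (S z)) -> False.
Proof.
move=> Sid Nz0 Smin; have sG := seminorm_orbit_gauge.
have e_gt0 := e0; have r_gt0 := r0; have rho_gt0 := rho0; have M1_gt0 := M1.
have th_rho := theta_rho; have th_M := theta_M; have th_e := theta_e.
have G_ge x : `‖x‖ <= (M + 1) * G x.
  have := gauge_lower (s := s) r0 thickened_orbit_ball M1 thickened_orbit_bounded x.
  by rewrite ler_pdivrMl.
have Sdist z : `‖S z - z‖ <= 2^-1 * `‖z‖.
  have h1 := G_ge (S z - z).
  have h2 : (M + 1) * G (S z - z) <= (M + 1) * (theta * N z).
    by rewrite ler_wpM2l// ltW.
  have h3 : (M + 1) * theta * N z <= (M + 1) * theta * (3 * `‖z‖).
    by rewrite ler_wpM2l// mulr_ge0// ltW.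
  have h4 : (6 * (M + 1) * theta) * `‖z‖ <= 1 * `‖z‖ by rewrite ler_wpM2r ?rnorm_ge0.
  by lra.
have [V [VS SV V2]] := near_identity_inverse Sdist.
(* The minimality of [z0] in homogeneous form is [m * N z <= G (S z)]: the inverse of [S] maps [m]
   times the ball of [G] into the ball of [N]. *)
pose m := G (S z0).
have Nhom z : m * N z <= G (S z).
  have [->|zn0] := eqVneq z 0.
    by rewrite linear0 (seminorm0 sG) (seminorm0 sN) mulr0.
  have Nz : 0 < N z by apply: lt_le_trans (N_ge z); exact: rnorm_gt0.
  have := Smin (ofR s (N z)^-1 *: z); rewrite sN.2 modulus_ofR gtr0_norm ?invr_gt0//.
  rewrite mulVf ?gt_eqF// => /(_ erefl); rewrite linearZ/= sG.2 modulus_ofR.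
  by rewrite gtr0_norm ?invr_gt0// mulrC ler_pdivlMr.
have z0n : 1 / 3 <= `‖z0‖ by have := N_le z0; rewrite Nz0; lra.
have z01 : `‖z0‖ <= 1 by rewrite -Nz0.
have m_ge : 1 <= 6 * (M + 1) * m.
  have h1 := Sid z0; have h2 := G_ge z0.
  have h3 := sG.1 (S z0) (z0 - S z0); rewrite addrC subrK in h3.
  have h4 : G (z0 - S z0) = G (S z0 - z0) by rewrite -opprB (seminormN _ sG).
  have h5 : (M + 1) * G z0 <= (M + 1) * (m + theta).
    by rewrite ler_wpM2l ?(ltW M1)//; rewrite Nz0 in h1; rewrite /m; lra.
  by lra.
have m0 : 0 < m.
  rewrite ltNge; apply/negP => mn.
  have : (M + 1) * m <= 0 by rewrite pmulr_rle0.
  by lra.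
(* Tested at a point [d n] of [B] with norm at least [e / 2]: there [G] is at most 1 and [S] moves
   it by little. *)
have m_le : m * e <= 3.
  have [n dn] := dn0; have Nd := N_ge (d n).
  have h1 := Nhom (d n); have h2 := Sid (d n).
  have h3 := sG.1 (S (d n) - d n) (d n); rewrite subrK in h3.
  have h4 : G (d n) <= 1 by apply: gauge_le1; exact: orbit_mem.
  have h5 : (m - theta) * N (d n) <= 1 by lra.
  have [mt|mt] := leP (m - theta) 0.
    have : (m - theta) * e <= 0 by rewrite mulr_le0_ge0// ltW.
    by lra.
  have : (m - theta) * (e / 2) <= (m - theta) * N (d n).
    by rewrite ler_wpM2l ?(ltW mt)// (le_trans dn).
  by lra.
pose x1 := ofR s m^-1 *: S z0.
have Sz0 : S z0 = ofR s m *: x1.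
  by rewrite /x1 scalerA -rmorphM mulfV ?gt_eqF// rmorph1 scale1r.
have Bx1 : B x1.
  apply: (gauge_le1_mem cB vB r0 thickened_orbit_ball).
  by rewrite -/G sG.2 modulus_ofR gtr0_norm ?invr_gt0// mulVf// gt_eqF.
have [u yu xu] := thickened_orbit_near Bx1 r0.
have [n yn] := yZ (ofR s m) yu (divr_gt0 rho0 (ltr0Sn _ 3)).
(* The three errors, from [z0] to [S z0], to [m u] and to [y n], are at most [rho / 4], [rho / 2]
   and [rho / 4]. *)
have z0y : `‖z0 - y n‖ <= rho.
  have h1 := rdistD s z0 (S z0) (y n).
  have h2 := rdistD s (S z0) (ofR s m *: u) (y n).
  have h3 : `‖S z0 - ofR s m *: u‖ = m * `‖x1 - u‖.
    by rewrite Sz0 -scalerBr rnormZr gtr0_norm.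
  have h4 : `‖z0 - S z0‖ <= (M + 1) * theta.
    rewrite rdistC; apply: le_trans (G_ge _) _; rewrite ler_wpM2l ?(ltW M1)//.
    by have := Sid z0; rewrite Nz0 mulr1.
  have h5 : m * `‖x1 - u‖ <= m * (r + r) by rewrite ler_wpM2l ?ltW.
  have h6 : m * (12 * r) <= m * (rho * e) by rewrite ler_wpM2l ?(ltW m0).
  have h7 : rho * (m * e) <= rho * 3 by rewrite ler_wpM2l ?(ltW rho0).
  by lra.
apply: (N_denting Nz0 z0y).
pose g x := V (ofR s m *: x).
have ga a b t : g (ofR s t *: a + ofR s (1 - t) *: b) =
    ofR s t *: g a + ofR s (1 - t) *: g b.
  have gZ c v : g (ofR s c *: v) = ofR s c *: g v.
    by rewrite /g scalerA mulrC -scalerA linearZ.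
  by rewrite -!gZ /g scalerDr linearD.
have gl a b : `‖g a - g b‖ <= 2 * m * `‖a - b‖.
  rewrite /g -linearB -scalerBr; apply: le_trans (V2 _) _.
  by rewrite rnormZr gtr0_norm// mulrA.
have -> : z0 = g x1 by rewrite /g -Sz0 SV.
apply: (hull_image ga gl _ (nondentable_thickened_orbit Bx1)) => x [Bx ex].
apply: subset_hull; split.
  have := Nhom (g x); rewrite /g VS sG.2 modulus_ofR gtr0_norm//.
  rewrite ler_pM2l// => /le_trans; apply; exact: gauge_le1.
rewrite /g -linearB -scalerBr; set v := V _.
(* Since [|S v| <= 3 / 2 * |v|], the distance [|v|] is at least [2 / 9 * (m * e)]. The lower bound
   on [m] and the choice of [w] give [w <= m * e / 6]. *)
have Sv : S v = ofR s m *: (x - x1) by rewrite /v VS.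
have h1 : `‖S v‖ = m * `‖x - x1‖ by rewrite Sv rnormZr gtr0_norm.
have h2 := Sdist v; have h3 := rnormD s (S v - v) v; rewrite subrK in h3.
have h4 : m * (e / 3) <= m * `‖x - x1‖ by rewrite ler_wpM2l ?(ltW m0).
have h5 : w * 1 <= w * (6 * (M + 1) * m) by rewrite ler_wpM2l ?(ltW w0).
have h6 : m * (w * (36 * (M + 1))) <= m * e by rewrite ler_wpM2l ?(ltW m0).
have h7 := rnorm_ge0 s v.
by lra.
Qed.

End thickened_orbit.

(** [Z2] is [X] with the dented norm [N] and [Z1] is [X] with the gauge [G]. The operator that
    cannot be approximated is the identity from [Z2] to [Z1]. *)
Lemma huff_renorming : nonzero_space X -> ~ radon_nikodym_property X ->
  exists Z1 Z2 : completeNormedModType K,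
    [/\ nonzero_space Z1, nonzero_space Z2, isomorphic Z1 X, isomorphic Z2 X &
        ~ MA_dense Z2 Z1].
Proof.
move=> X0 nrnp; have [C [C0 bC nC]] : exists C : set X,
    [/\ C !=set0, bounded_set C & ~ dentable C].
  apply: contrapT => nex; apply: nrnp => C C0 _ bC; apply: contrapT => nC.
  by apply: nex; exists C.
have [e e0 eC] := (not_dentableP s C).1 nC.
have [M CM] := (bounded_setP s C).1 bC.
have [d [Cd nd]] := countable_nondentable C0 eC.
have dM n : `‖d n‖ <= M by exact: CM.
have M0 : 0 <= M by apply: le_trans (dM 0%N); exact: rnorm_ge0.
have [y [yd yD yZ]] := countable_span s d.
have [N [sN N_ge N_le Nd]] := denting_renorming s y.
have M1 : 0 < M + 1 by rewrite ltr_wpDl.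
have M36 : 0 < 36 * (M + 1) by rewrite mulr_gt0.
(* Nondentability provides some [d n] at distance at least [e] from [d 0], so one of the two has
   norm at least [e / 2]. *)
have dn0 : exists n, e / 2 <= `‖d n‖.
  have d0 : range d (d 0%N) by exists 0%N.
  have [_ [[n _ <-] en]] := hull_nonempty (nd _ d0).
  have := rnormB s (d n) (d 0%N).
  have [h|h] := leP (e / 2) `‖d n‖; first by exists n.
  by exists 0%N; lra.
(* [N] depends on [y] only, so the constants are chosen in turn: the size [w] of the dents, the
   radius [rho] from the equations of [denting_renorming], the thickness [r] of the orbit, small
   against [rho], and the distance [th] to the identity. *)
pose w := Num.min 1 (e / (36 * (M + 1))).
have w0 : 0 < w by rewrite lt_min ltr01/= divr_gt0.
have w1 : w <= 1 by rewrite ge_min lexx.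
have w_le : w * (36 * (M + 1)) <= e by rewrite -ler_pdivlMr// ge_min lexx orbT.
pose k := w * w / (8 * (8 * 8)); pose rho := k * k / (6 * 6).
have kE : w * w = 8 * (8 * (8 * k)) by rewrite /k; field.
have rE : k * k = 6 * (6 * rho) by rewrite /rho; field.
have k0 : 0 < k by rewrite divr_gt0 ?mulr_gt0.
have rho0 : 0 < rho by rewrite divr_gt0 ?mulr_gt0.
pose r := Num.min 1 (rho * e / 12).
have r0 : 0 < r by rewrite lt_min ltr01/= divr_gt0// mulr_gt0.
have r1 : r <= 1 by rewrite ge_min lexx.
have r_le : 12 * r <= rho * e by rewrite mulrC -ler_pdivlMr// ge_min lexx orbT.
pose th := Num.min (rho / (4 * (M + 1))) (Num.min (6 * (M + 1))^-1 e^-1).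
have th0 : 0 < th by rewrite !lt_min divr_gt0 ?mulr_gt0//= !invr_gt0 e0 mulr_gt0.
have th_rho : 4 * (M + 1) * th <= rho.
  by rewrite mulrC -ler_pdivlMr ?mulr_gt0// ge_min lexx.
have th_M : 6 * (M + 1) * th <= 1.
  rewrite mulrC -ler_pdivlMr ?mulr_gt0// mul1r /th.
  by rewrite !ge_min lexx !orbT.
have th_e : th * e <= 1.
  by rewrite -ler_pdivlMr// mul1r /th !ge_min lexx !orbT.
pose E := [set x : X | exists k n b,
  [/\ modulus s k = 1, `‖b‖ <= r & x = k *: d n + b]].
pose G := gauge s (closed_convex_hull E).
have [cB vB] : closed (closed_convex_hull E) /\
    convex_set (closed_convex_hull E : set (convex_lmodType X)).
  by split; [exact: closed_hull|exact: convex_hull].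
have [GD GZ] : seminorm s G by exact: seminorm_orbit_gauge.
have ballB : forall x, `‖x‖ <= r -> closed_convex_hull E x.
  by move=> x; exact: thickened_orbit_ball.
have hG : equivalent_norm s G.
  split => //.
    exists (M + 1)^-1; first by rewrite invr_gt0.
    by move=> x; apply: (gauge_lower r0 ballB M1) => z; exact: thickened_orbit_bounded.
  exists r^-1; first by rewrite invr_gt0.
  move=> x; apply: (gauge_upper vB) => //.
  by move=> l z; exact: thickened_orbit_balanced.
have hN : equivalent_norm s N.
  split; [exact: sN.1|exact: sN.2| |by exists 3].
  by exists 1 => // x; rewrite mul1r.
pose Z1 := renormed_space hG; pose Z2 := renormed_space hN.
exists Z1, Z2; split; [by []|by []|exact: renormed_isomorphic|exact: renormed_isomorphic|].
move=> dense.
have idl : linear (idfun : Z2 -> Z1) by [].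
have bid : bounded_operator (linear_of idl).
  apply/(bounded_operatorP s); have [b b0 Gb] := eqnorm_upper hG.
  exists b => [|x]; first exact: ltW.
  rewrite linear_ofE !renormed_rnorm; apply: le_trans (Gb x) _.
  by rewrite ler_wpM2l ?(ltW b0).
have th_gt0 : 0 < ofR s th by rewrite ofR_gt0.
have [S [bS /(attains_min_normP s)[z0 z01 Smin]] Sid] := dense _ bid _ th_gt0.
have {}Sid := op_norm_dist_lt bS bid Sid.
have Sl : linear (S : X -> X) by exact: linearP.
have SidX z : G (linear_of Sl z - z) <= th * N z.
  by have := Sid z; rewrite !renormed_rnorm.
have z0N : N z0 = 1 by rewrite -z01 renormed_rnorm.
have SminX z : N z = 1 -> G (linear_of Sl z0) <= G (linear_of Sl z).
  by move=> Nz; have := Smin z; rewrite !renormed_rnorm; apply.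
have Ndw n z : N z = 1 -> `‖z - y n‖ <= rho ->
    ~ closed_convex_hull [set x | N x <= 1 /\ w <= `‖x - z‖] z.
  exact: Nd w0 w1 kE rE.
exact: (no_minimum_near_identity e0 nd dM r0 r1 yd yD yZ dn0 sN N_ge N_le Ndw
  rho0 M0 w0 (ltW th0) w_le r_le th_rho th_M th_e SidX z0N SminX).
Qed.

End huff_renorming.

(** * The equivalence *)

Section characterization.
Context {R : realType} {K : numFieldType} (s : scalar_field R K).

(** The property of [X] is asked for only in the presence of an operator bounded below: for A_M it
    is given, for B_M it is inherited from [Y] through that operator. *)
Lemma MA_dense_rnp (X Y : completeNormedModType K) : nonzero_space X ->
    (forall T : {linear X -> Y}, bounded_operator T -> bounded_below s T ->
      radon_nikodym_property X) ->
  MA_dense X Y.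
Proof.
move=> X0 rnpX T bT _ /(gt0_ofR s)[e e0 ->].
have [Tb|nTb] := pselect (bounded_below s T); last exact: MA_approx_not_below.
by apply: MA_approx_below => //; exact: rnpX Tb.
Qed.

Lemma isomorphic_rnp (X Z : completeNormedModType K) : isomorphic Z X ->
  radon_nikodym_property X -> radon_nikodym_property Z.
Proof.
move=> [f [g [fK _ /(continuous_linearP s) cf /(continuous_linearP s)[c c0 gc]]]].
apply: (rnp_bounded_below (s := s) (T := f)); first exact/(bounded_operatorP s).
have c1 : 0 < c + 1 by rewrite ltr_wpDl.
exists (c + 1)^-1; first by rewrite invr_gt0.
move=> z; rewrite ler_pdivrMl//; have := gc (f z); rewrite fK => /le_trans; apply.
by rewrite ler_wpM2r ?rnorm_ge0// lerDl.
Qed.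

Lemma rnp_AM (X : completeNormedModType K) : nonzero_space X ->
  radon_nikodym_property X -> property_AM X.
Proof. by move=> X0 rnpX Y _; apply: MA_dense_rnp. Qed.

Lemma rnp_BM (X : completeNormedModType K) :
  radon_nikodym_property X -> property_BM X.
Proof.
move=> rnpX Y Y0; apply: MA_dense_rnp => // T bT Tb.
exact: rnp_bounded_below bT Tb rnpX.
Qed.

End characterization.

Theorem theorem2p6 (R : realType) (K : numFieldType)
  (hK : K = R :> numFieldType \/ K = R[i] :> numFieldType)
  (X : completeNormedModType K) (hX : nonzero_space X) :
  [<-> radon_nikodym_property X;
       forall Z : completeNormedModType K,
         nonzero_space Z -> isomorphic Z X -> property_AM Z;
       forall Z : completeNormedModType K,
         nonzero_space Z -> isomorphic Z X -> property_BM Z].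
Proof.
have [s] : inhabited (scalar_field R K).
  case: hK => ->; constructor; first exact: scalar_field_real.
  exact: scalar_field_complex.
(* Also the way from A_M to B_M: it passes through the Radon-Nikodym property. *)
have AM_rnp : (forall Z : completeNormedModType K,
    nonzero_space Z -> isomorphic Z X -> property_AM Z) -> radon_nikodym_property X.
  move=> AM; apply: contrapT => /(huff_renorming s hX)[Z1 [Z2 [Z10 Z20 _ iso2]]].
  by apply; exact: AM.
tfae => [rnpX Z Z0 iso|/AM_rnp rnpX Z Z0 iso|BM].
- exact/(rnp_AM s Z0)/(isomorphic_rnp s iso).
- exact/(rnp_BM s)/(isomorphic_rnp s iso).
- apply: contrapT => /(huff_renorming s hX)[Z1 [Z2 [Z10 Z20 iso1 _]]].
  by apply; exact: BM.
Qed.
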